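(* Let $X \subseteq \mathbb{N} \setminus \{0\}$ be a Boolean combination of $\Sigma_2$ sets, thought of as a set of finite order-types. Then there is a computable copy $\mathcal{L}$ of $\omega$ such that for every $\Delta_2$ cohesive set $C$, the cohesive power $\prod_C \mathcal{L}$ has order-type $\omega + \boldsymbol{\sigma}(X \cup \{\omega + \zeta\eta + \omega^*\})$. Moreover, if $X$ is finite and non-empty, then there is also a computable copy $\mathcal{L}$ of $\omega$ such that for every $\Delta_2$ cohesive set $C$, the cohesive power $\prod_C \mathcal{L}$ has order-type $\omega + \boldsymbol{\sigma}(X)$.
   Context: $\Sigma_n, \Pi_n, \Delta_n$ refer to the arithmetical hierarchy of subsets of $\mathbb{N}$; a set is c.e. (computably enumerable) if it is $\Sigma_1$. For $X, Y \subseteq \mathbb{N}$, $X \subseteq^* Y$ means that $X \setminus Y$ is finite. A set $C \subseteq \mathbb{N}$ is cohesive if it is infinite and for every c.e. set $W$, either $C \subseteq^* W$ or $C \subseteq^* \mathbb{N} \setminus W$. A computable linear order $\mathcal{L} = (L; \prec_{\mathcal{L}})$ consists of a non-empty computable set $L \subseteq \mathbb{N}$ and a computable (strict) linear order relation $\prec_{\mathcal{L}}$ on $L$. A computable copy of $\omega$ is a computable linear order that is isomorphic to $(\mathbb{N}; <)$ (by a not necessarily computable isomorphism). Cohesive power: for a computable linear order $\mathcal{L} = (L; \prec_{\mathcal{L}})$ and a cohesive set $C$, let $D$ be the set of partial computable functions $\varphi \colon \mathbb{N} \rightharpoonup L$ with $C \subseteq^* \mathrm{dom}(\varphi)$. For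 $\varphi, \psi \in D$, let $\varphi =_C \psi$ if $C \subseteq^* \{n : \varphi(n)\downarrow = \psi(n)\downarrow\}$; this is an equivalence relation, and $[\varphi]$ denotes the class of $\varphi$. The cohesive power $\prod_C \mathcal{L}$ is the linear order with domain $\{[\varphi] : \varphi \in D\}$ where $[\psi] \prec [\varphi]$ if and only if $C \subseteq^* \{n : \psi(n)\downarrow \prec_{\mathcal{L}} \varphi(n)\downarrow\}$. Order-types: $\omega$, $\zeta$, $\eta$ are the order-types of $(\mathbb{N};<)$, $(\mathbb{Z};<)$, $(\mathbb{Q};<)$ respectively; $\omega^*$ is the reverse of $\omega$; $+$ is the usual sum of linear orders; $\zeta\eta$ is the order obtained from $\mathbb{Q}$ by replacing each point by a copy of $\mathbb{Z}$. A number $n \geq 1$ is identified with the order-type of the linear order $(\{0, 1, \dots, n-1\}; <)$. Shuffle: for a non-empty, at-most-countable collection $Y$ of order-types, let $f \colon \mathbb{Q} \to Y$ be any function such that $f^{-1}(\alpha)$ is dense in $\mathbb{Q}$ for each $\alpha \in Y$. The shuffle $\boldsymbol{\sigma}(Y)$ is the order-type of the linear order $\sum_{q \in \mathbb{Q}} f(q)$ obtained by replacing each $q \in \mathbb{Q}$ by a linear order of type $f(q)$; it does not depend on the choice of $f$. *)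

(* Defs.v *)
From Stdlib Require Import Cantor.
From mathcomp Require Import all_boot all_order all_algebra.
From mathcomp Require Import mathcomp_extra boolp classical_sets functions cardinality.

Set Implicit Arguments.
Unset Strict Implicit.
Unset Printing Implicit Defensive.

Local Open Scope nat_scope.
Local Open Scope classical_set_scope.

(* Partial recursive functions of one variable; functions of several variables
   are obtained through the Cantor pairing bijection. *)

Definition pair_nat (x y : nat) : nat := Cantor.to_nat (x, y).
Definition fst_nat (n : nat) : nat := (Cantor.of_nat n).1.
Definition snd_nat (n : nat) : nat := (Cantor.of_nat n).2.

Inductive code : Type :=
| CZero
| CSucc
| CFst
| CSnd
| CPair of code & code
| CComp of code & code
| CRec of code & code
| CMu of code.

(* [prim_rec F G a n y]: [y] is the [n]-th value of the recursion with
   [h 0 = F a] and [h k.+1 = G (pair_nat a (pair_nat k (h k)))]. *)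
Fixpoint prim_rec (F G : nat -> nat -> Prop) (a n y : nat) : Prop :=
  match n with
  | 0 => F a y
  | k.+1 => exists2 z, prim_rec F G a k z & G (pair_nat a (pair_nat k z)) y
  end.

(* [eval c n y]: program [c] halts on input [n] with output [y]. *)
Fixpoint eval (c : code) (n y : nat) : Prop :=
  match c with
  | CZero => y = 0
  | CSucc => y = n.+1
  | CFst => y = fst_nat n
  | CSnd => y = snd_nat n
  | CPair f g => exists a b, [/\ eval f n a, eval g n b & y = pair_nat a b]
  | CComp f g => exists2 m, eval g n m & eval f m y
  | CRec f g => prim_rec (eval f) (eval g) (fst_nat n) (snd_nat n) y
  | CMu f => eval f (pair_nat n y) 0 /\
             forall i, i < y -> exists z, eval f (pair_nat n i) z.+1
  end.

Definition pfun := nat -> option nat.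

Definition partial_computable (phi : pfun) : Prop :=
  exists c, forall n y, phi n = Some y <-> eval c n y.

Definition computable (A : set nat) : Prop :=
  exists c, forall n, (A n -> eval c n 1) /\ (~ A n -> eval c n 0).

Definition computable_rel (R : nat -> nat -> Prop) : Prop :=
  computable [set n | R (fst_nat n) (snd_nat n)].

(* The set [B] below is a [Pi_n] binary relation, coded by pairing. *)
Fixpoint Sigma (n : nat) (A : set nat) : Prop :=
  match n with
  | 0 => computable A
  | k.+1 => exists2 B : set nat, Sigma k (~` B) &
              forall x, A x <-> exists y, B (pair_nat x y)
  end.

Definition Pi (n : nat) (A : set nat) : Prop := Sigma n (~` A).

Definition Delta (n : nat) (A : set nat) : Prop := Sigma n A /\ Pi n A.

Definition ce (A : set nat) : Prop := Sigma 1 A.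

Inductive boolean_combination (F : set nat -> Prop) : set nat -> Prop :=
| bc_base A : F A -> boolean_combination F A
| bc_compl A : boolean_combination F A -> boolean_combination F (~` A)
| bc_union A B : boolean_combination F A -> boolean_combination F B ->
    boolean_combination F (A `|` B)
| bc_inter A B : boolean_combination F A -> boolean_combination F B ->
    boolean_combination F (A `&` B).

Definition almost_subset (A B : set nat) : Prop := finite_set (A `\` B).

Definition cohesive (C : set nat) : Prop :=
  infinite_set C /\
  forall W, ce W -> almost_subset C W \/ almost_subset C (~` W).

(* Order-types are represented by such structures, up to [iso]. *)
Record order_str : Type := OrderStr {
  carrier :> Type;
  prec : carrier -> carrier -> Prop
}.

Definition iso (A B : order_str) : Prop :=
  exists2 f : A -> B, bijective f & forall x y, prec x y <-> prec (f x) (f y).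

Definition omega : order_str := @OrderStr nat (fun x y => x < y).
Definition zeta : order_str := @OrderStr int (fun x y => (x < y)%R).
Definition eta : order_str := @OrderStr rat (fun x y => (x < y)%R).
Definition fin_order (n : nat) : order_str := @OrderStr 'I_n (fun x y => x < y).
Definition reverse (A : order_str) : order_str :=
  @OrderStr A (fun x y => prec y x).

Definition plus (A B : order_str) : order_str :=
  @OrderStr (A + B)%type (fun u v =>
    match u, v with
    | inl x, inl y => prec x y
    | inl _, inr _ => True
    | inr _, inl _ => False
    | inr x, inr y => prec x y
    end).

Inductive lex (I : order_str) (F : I -> order_str) :
    {i : I & F i} -> {i : I & F i} -> Prop :=
| lex_index i j (x : F i) (y : F j) :
    prec i j -> lex (existT _ i x) (existT _ j y)
| lex_fibre i (x y : F i) :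
    prec x y -> lex (existT _ i x) (existT _ i y).

Definition order_sum (I : order_str) (F : I -> order_str) : order_str :=
  @OrderStr {i : I & F i} (@lex I F).

Definition zeta_eta : order_str := order_sum (fun _ : eta => zeta).

(* Collections of order-types, given by representatives; these are plain
   predicates because [set] lives in too small a universe. *)
Definition finite_types (X : set nat) (Z : order_str) : Prop :=
  exists2 n, X n & Z = fin_order n.

Definition finite_types_with (X : set nat) (A Z : order_str) : Prop :=
  finite_types X Z \/ Z = A.

(* [S] has order-type [sigma(Y)]; the fibres of [f] are taken up to [iso]
   because they are the fibres over order-types. *)
Definition is_shuffle (Y : order_str -> Prop) (S : order_str) : Prop :=
  exists f : eta -> order_str,
  [/\ forall q, Y (f q),
      forall Z, Y Z -> forall a b : rat, (a < b)%R ->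
        exists q : rat, (a < q < b)%R /\ iso (f q) Z
    & iso S (order_sum f)].

Record computable_linear_order : Type := ComputableLinearOrder {
  clo_dom : set nat;
  clo_lt : nat -> nat -> Prop;
  clo_nonempty : clo_dom !=set0;
  clo_dom_computable : computable clo_dom;
  clo_lt_computable : computable_rel clo_lt;
  clo_lt_dom : forall x y, clo_lt x y -> clo_dom x /\ clo_dom y;
  clo_irrefl : forall x, ~ clo_lt x x;
  clo_trans : forall x y z, clo_lt x y -> clo_lt y z -> clo_lt x z;
  clo_total : forall x y, clo_dom x -> clo_dom y ->
    [\/ clo_lt x y, x = y | clo_lt y x]
}.

Definition clo_order (L : computable_linear_order) : order_str :=
  @OrderStr {x : nat | clo_dom L x} (fun x y => clo_lt L (sval x) (sval y)).

Definition computable_copy_of_omega (L : computable_linear_order) : Prop :=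
  iso (clo_order L) omega.

Section CohesivePower.
Variables (L : computable_linear_order) (C : set nat).

Definition cp_fun (phi : pfun) : Prop :=
  [/\ partial_computable phi,
      forall n y, phi n = Some y -> clo_dom L y
    & almost_subset C [set n | phi n <> None]].

Definition cp_eq (phi psi : pfun) : Prop :=
  almost_subset C [set n | exists x, phi n = Some x /\ psi n = Some x].

Definition cp_lt (phi psi : pfun) : Prop :=
  almost_subset C
    [set n | exists x y, [/\ phi n = Some x, psi n = Some y & clo_lt L x y]].

Definition cp_class (phi : pfun) : set pfun :=
  [set psi | cp_fun psi /\ cp_eq phi psi].

Definition cohesive_power : order_str :=
  @OrderStr {K : set pfun | exists2 phi, cp_fun phi & K = cp_class phi}
    (fun K1 K2 =>
      exists phi psi, [/\ sval K1 phi, sval K2 psi & cp_lt phi psi]).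

End CohesivePower.

Definition has_type_omega_plus_shuffle (Y : order_str -> Prop) (A : order_str)
    : Prop :=
  exists2 S, is_shuffle Y S & iso A (plus omega S).

(* Main.v *)
Require Import Defs.
From Stdlib Require Import Cantor.
From Stdlib Require List.
From mathcomp Require Import all_boot all_order all_algebra.
From mathcomp Require Import mathcomp_extra boolp classical_sets functions cardinality.
From mathcomp Require Import zify.

(* The order is laid out in levels [0 < 1 < 2 < ...], each of them finite.  A level
   is built in stages: at every active stage, elements of all available colors
   are inserted, at dyadic positions, into all gaps left by the earlier stages.
   A level has finitely many active stages, so the order has type omega, but its
   last active stage cannot be computed: level [j] is made to act whenever one of
   [j+1] approximations to parities changes, and the limits of these parities
   split every infinite Sigma_2 set.  Hence, along a Sigma_2 cohesive set [C],
   every element of the cohesive power whose level tends to infinity lies, almost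
   everywhere, at a stage that is not the last one, and between any two such
   elements of different blocks the last stages provide an element of every
   color that is available in almost all levels.

   An element of the order is really a finite block.  A set [X] as in the theorem
   is a finite union of differences [A \ B] of Sigma_2 sets; a color is a guess
   [(k, w)] that [w] witnesses [k \in A].  Its blocks have size [k] until the guess
   is refuted, after which they are enlarged to sizes growing with the level, and
   it is available at level [j] once [k] has left the first [j+1] Pi_1 components of
   [B].  So in the power a block has finite size [k \in X], or it is a cohesive
   power of finite orders of unbounded sizes, which has type
   omega + zeta eta + omega^*.  Cantor's theorem then identifies the order of the
   nonstandard blocks with the rationals. *)

Set Implicit Arguments.
Unset Strict Implicit.
Unset Printing Implicit Defensive.

Local Open Scope nat_scope.
Local Open Scope classical_set_scope.

(** * Computable functions *)

Arguments pair_nat : simpl never.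
Arguments fst_nat : simpl never.
Arguments snd_nat : simpl never.

(** Two obstacles shape the construction. First, the last active stage of a level must escape every
    function computable along [C]. If such a function bounded it almost everywhere, each limit
    parity would be computable along [C], because level [j] watches every parity of index at most
    [j] and the levels tend to infinity. By cohesiveness the parity would then be almost constant
    along [C]. But the levels met along [C] form an infinite Sigma_2 set, which has an element in
    each interval of its own cutting, hence elements of both parities. Second, a block must grow
    upon a refutation that no bounded search detects, although its elements have to form a
    computable set. The additional elements therefore carry indices shifted by the least refuter
    [z], so that index [m] only asks about [z <= m]; along [C] the shift is computable and can be
    subtracted again. One dichotomy is used throughout: a function computable along [C] is almost
    constant or almost everywhere above each number. It separates standard from nonstandard
    elements, finite blocks from infinite ones, and near points of a block from distant ones. *)

Lemma fst_pair x y : fst_nat (pair_nat x y) = x.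
Proof. by rewrite /fst_nat /pair_nat Cantor.cancel_of_to. Qed.

Lemma snd_pair x y : snd_nat (pair_nat x y) = y.
Proof. by rewrite /snd_nat /pair_nat Cantor.cancel_of_to. Qed.

Lemma pair_eta n : pair_nat (fst_nat n) (snd_nat n) = n.
Proof.
rewrite /fst_nat /snd_nat /pair_nat -surjective_pairing.
exact: Cantor.cancel_to_of.
Qed.

(* Otherwise unification unfolds the Cantor pairing. *)
Opaque pair_nat fst_nat snd_nat.

Definition pairE := (fst_pair, snd_pair).

Lemma pair_inj x y x' y' : pair_nat x y = pair_nat x' y' -> x = x' /\ y = y'.
Proof.
move=> e; split; first by rewrite -(fst_pair x y) e fst_pair.
by rewrite -(snd_pair x y) e snd_pair.
Qed.

Lemma leq_pair x y : (x <= pair_nat x y) * (y <= pair_nat x y).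
Proof.
have /leP h := Cantor.to_nat_non_decreasing x y.
by split; apply: leq_trans h; rewrite ?leq_addl ?leq_addr.
Qed.

Lemma eval_fun c n y y' : eval c n y -> eval c n y' -> y = y'.
Proof.
elim: c n y y' => [||||f IHf g IHg|f IHf g IHg|f IHf g IHg|f IHf] n y y' /=.
- by move=> -> ->.
- by move=> -> ->.
- by move=> -> ->.
- by move=> -> ->.
- move=> [a [b [fa gb ->]]] [a' [b' [fa' gb' ->]]].
  by rewrite (IHf _ _ _ fa fa') (IHg _ _ _ gb gb').
- move=> [m gm fy] [m' gm' fy'].
  by move: fy'; rewrite -(IHg _ _ _ gm gm') => /(IHf _ _ _ fy).
- elim: (snd_nat n) y y' => [|k IHk] y y' /=; first exact: IHf.
  by move=> [z hz gz] [z' /(IHk _ _ hz) <- /(IHg _ _ _ gz)].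
- move=> [f0 lt0] [f0' lt0']; case: (ltngtP y y') => // lt_y.
    by have [z /(IHf _ _ _ f0)] := lt0' _ lt_y.
  by have [z /(IHf _ _ _ f0')] := lt0 _ lt_y.
Qed.

(** Total computable functions; a predicate counts as one through the coercion of booleans to 0 and
    1. The closure properties below are assembled by [tc_auto], so that programs rarely have to be
    written out. *)
Definition tc (f : nat -> nat) := exists c, forall n, eval c n (f n).

Lemma tc_id : tc (fun x => x).
Proof.
exists (CPair CFst CSnd) => n /=; exists (fst_nat n), (snd_nat n).
by rewrite pair_eta.
Qed.

Lemma tc_comp f g : tc f -> tc g -> tc (fun x => f (g x)).
Proof. by move=> [c Hc] [d Hd]; exists (CComp c d) => n /=; exists (g n). Qed.

Lemma tc_succ f : tc f -> tc (fun x => (f x).+1).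
Proof. by apply: tc_comp; exists CSucc. Qed.

Lemma tc_fst f : tc f -> tc (fun x => fst_nat (f x)).
Proof. by apply: tc_comp; exists CFst. Qed.

Lemma tc_snd f : tc f -> tc (fun x => snd_nat (f x)).
Proof. by apply: tc_comp; exists CSnd. Qed.

Lemma tc_pair f g : tc f -> tc g -> tc (fun x => pair_nat (f x) (g x)).
Proof.
by move=> [c Hc] [d Hd]; exists (CPair c d) => n /=; exists (f n), (g n).
Qed.

Lemma tc_const k : tc (fun _ => k).
Proof. by elim: k => [|k /tc_succ //]; exists CZero. Qed.

Definition tc2 (f : nat -> nat -> nat) := tc (fun x => f (fst_nat x) (snd_nat x)).
Definition tc3 (f : nat -> nat -> nat -> nat) :=
  tc2 (fun x y => f x (fst_nat y) (snd_nat y)).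
Definition tc4 (f : nat -> nat -> nat -> nat -> nat) :=
  tc3 (fun x y z => f x y (fst_nat z) (snd_nat z)).

Lemma tc_app2 f g h : tc2 f -> tc g -> tc h -> tc (fun x => f (g x) (h x)).
Proof.
move=> Hf Hg Hh; have := tc_comp Hf (tc_pair Hg Hh).
by under eq_fun do rewrite !pairE.
Qed.

Lemma tc_app3 f g h k : tc3 f -> tc g -> tc h -> tc k ->
  tc (fun x => f (g x) (h x) (k x)).
Proof.
move=> Hf Hg Hh Hk; have := @tc_app2 (fun a b => f a (fst_nat b) (snd_nat b)) _ _ Hf Hg (tc_pair Hh Hk).
by under eq_fun do rewrite !pairE.
Qed.

Lemma tc_app4 f g h k l : tc4 f -> tc g -> tc h -> tc k -> tc l ->
  tc (fun x => f (g x) (h x) (k x) (l x)).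
Proof.
move=> Hf Hg Hh Hk Hl; have := @tc_app3 (fun a b c => f a b (fst_nat c) (snd_nat c)) _ _ _ Hf Hg Hh (tc_pair Hk Hl).
by under eq_fun do rewrite !pairE.
Qed.

(** [CRec] hands the parameter, the counter and the previous value to its step as nested pairs,
    which is the argument format of [tc3]. The bounded loops below all reduce to this one. *)
Lemma tc_iteri b G F : tc b -> tc3 G -> tc F ->
  tc (fun x => iteri (b x) (G x) (F x)).
Proof.
move=> Hb [cG HG] [cF HF].
suff : tc2 (fun x k => iteri k (G x) (F x)) by move/tc_app2; apply=> //; apply: tc_id.
exists (CRec cF cG) => n /=; elim: (snd_nat n) => [|k IH] /=; first exact: HF.
exists (iteri k (G (fst_nat n)) (F (fst_nat n))) => //.
by have := HG (pair_nat (fst_nat n) (pair_nat k (iteri k (G (fst_nat n)) (F (fst_nat n)))));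
  rewrite !pairE.
Qed.

Lemma tc_eq f g : f =1 g -> tc f -> tc g.
Proof. by move=> /funext ->. Qed.

Lemma tc_pred f : tc f -> tc (fun x => (f x).-1).
Proof.
apply: (@tc_comp predn).
apply: (@tc_eq (fun x => iteri x (fun k _ => k) 0)); first by case.
apply: tc_iteri; [exact: tc_id| |exact: tc_const].
by apply: tc_fst; apply: tc_snd; apply: tc_id.
Qed.

Lemma tc_add f g : tc f -> tc g -> tc (fun x => f x + g x).
Proof.
move=> Hf Hg; apply: (@tc_eq (fun x => iteri (g x) (fun _ z => z.+1) (f x))).
  by move=> x; elim: (g x) => [|k /= ->]; rewrite ?addn0 ?addnS.
apply: tc_iteri => //; do !apply: tc_succ; do !apply: tc_snd; exact: tc_id.
Qed.

Lemma tc_sub f g : tc f -> tc g -> tc (fun x => f x - g x).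
Proof.
move=> Hf Hg; apply: (@tc_eq (fun x => iteri (g x) (fun _ z => z.-1) (f x))).
  by move=> x; elim: (g x) => [|k /= ->]; rewrite ?subn0 ?subnS.
apply: tc_iteri => //; apply: tc_pred; do !apply: tc_snd; exact: tc_id.
Qed.

Lemma tc_mul f g : tc f -> tc g -> tc (fun x => f x * g x).
Proof.
move=> Hf Hg; apply: (@tc_eq (fun x => iteri (g x) (fun _ z => f x + z) 0)).
  by move=> x; elim: (g x) => [|k /= ->]; rewrite ?muln0 ?mulnS.
apply: tc_iteri => //; last exact: tc_const.
apply: tc_add; first by apply: tc_comp => //; apply: tc_fst; apply: tc_id.
do !apply: tc_snd; exact: tc_id.
Qed.

Lemma tc_exp f g : tc f -> tc g -> tc (fun x => f x ^ g x).
Proof.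
move=> Hf Hg; apply: (@tc_eq (fun x => iteri (g x) (fun _ z => f x * z) 1)).
  by move=> x; elim: (g x) => [|k /= ->]; rewrite ?expn0 ?expnS.
apply: tc_iteri => //; last exact: tc_const.
apply: tc_mul; first by apply: tc_comp => //; apply: tc_fst; apply: tc_id.
do !apply: tc_snd; exact: tc_id.
Qed.

Lemma tc_negb (P : nat -> bool) : tc (fun x => P x) -> tc (fun x => ~~ P x).
Proof.
move=> HP; apply: (@tc_eq (fun x => 1 - P x)); first by move=> x; case: (P x).
by apply: tc_sub => //; apply: tc_const.
Qed.

Lemma tc_andb (P Q : nat -> bool) : tc (fun x => P x) -> tc (fun x => Q x) ->
  tc (fun x => P x && Q x).
Proof.
move=> HP HQ; apply: (@tc_eq (fun x => P x * Q x)); last exact: tc_mul.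
by move=> x; rewrite mulnb.
Qed.

Lemma tc_orb (P Q : nat -> bool) : tc (fun x => P x) -> tc (fun x => Q x) ->
  tc (fun x => P x || Q x).
Proof.
move=> HP HQ; apply: (@tc_eq (fun x => ~~ (~~ P x && ~~ Q x))).
  by move=> x; rewrite negb_and !negbK.
by apply: tc_negb; apply: tc_andb; apply: tc_negb.
Qed.

Lemma tc_if (P : nat -> bool) f g : tc (fun x => P x) -> tc f -> tc g ->
  tc (fun x => if P x then f x else g x).
Proof.
move=> HP Hf Hg; apply: (@tc_eq (fun x => P x * f x + ~~ P x * g x)).
  by move=> x; case: (P x); rewrite /= ?mul0n ?mul1n ?addn0.
by apply: tc_add; apply: tc_mul => //; apply: tc_negb.
Qed.

Lemma tc_ifb (P f g : nat -> bool) : tc (fun x => P x) -> tc (fun x => f x) -> tc (fun x => g x) ->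
  tc (fun x => if P x then f x else g x : bool).
Proof.
move=> HP Hf Hg; apply: (@tc_eq (fun x => if P x then f x : nat else g x)).
  by move=> x; case: (P x).
exact: tc_if.
Qed.

Lemma tc_leq f g : tc f -> tc g -> tc (fun x => f x <= g x).
Proof.
move=> Hf Hg; apply: (@tc_eq (fun x => 1 - (f x - g x))).
  by move=> x; rewrite /leq; case: (f x - g x).
by apply: tc_sub; [apply: tc_const|apply: tc_sub].
Qed.

Lemma tc_eqn f g : tc f -> tc g -> tc (fun x => f x == g x).
Proof.
move=> Hf Hg; apply: (@tc_eq (fun x => (f x <= g x) && (g x <= f x))).
  by move=> x; rewrite -eqn_leq.
by apply: tc_andb; apply: tc_leq.
Qed.

Lemma tc_eqb (f g : nat -> bool) : tc (fun x => f x) -> tc (fun x => g x) ->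
  tc (fun x => f x == g x).
Proof.
move=> Hf Hg; apply: (@tc_eq (fun x => (f x : nat) == g x)).
  by move=> x; case: (f x) (g x) => -[].
exact: tc_eqn.
Qed.

Lemma tc_odd f : tc f -> tc (fun x => odd (f x)).
Proof.
move=> Hf; apply: (@tc_eq (fun x => iteri (f x) (fun _ z => 1 - z) 0)).
  by move=> x; elim: (f x) => //= k ->; case: (odd k).
apply: tc_iteri => //; last exact: tc_const.
by apply: tc_sub; [apply: tc_const|do !apply: tc_snd; apply: tc_id].
Qed.

Definition bex m (P : nat -> bool) : bool := has P (iota 0 m).

Lemma bexP m (P : nat -> bool) : reflect (exists2 i, i < m & P i) (bex m P).
Proof.
apply: (iffP hasP) => -[i]; first by rewrite mem_iota add0n /= => lt Pi; exists i.
by move=> lt Pi; exists i; rewrite // mem_iota.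
Qed.

Definition ball m (P : nat -> bool) : bool := all P (iota 0 m).

Lemma ballP m (P : nat -> bool) : reflect (forall i, i < m -> P i) (ball m P).
Proof.
apply: (iffP allP) => H i; first by move=> lt; apply: H; rewrite mem_iota.
by rewrite mem_iota add0n /= => /H.
Qed.

Lemma tc_bex b (P : nat -> nat -> bool) : tc b -> tc2 (fun x i => P x i) ->
  tc (fun x => bex (b x) (P x)).
Proof.
move=> Hb HP.
apply: (@tc_eq (fun x => iteri (b x) (fun i z => (0 < z) || P x i) 0)).
  move=> x; rewrite /bex; elim: (b x) => // k IH.
  by rewrite -[in RHS]addn1 iotaD add0n has_cat /= orbF IH; case: (has _ _).
apply: tc_iteri => //; last exact: tc_const.
apply: tc_orb; last first.
  apply: (tc_app2 HP); first by apply: tc_fst; apply: tc_id.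
  by apply: tc_fst; apply: tc_snd; apply: tc_id.
by apply: tc_leq; [apply: tc_const|do !apply: tc_snd; apply: tc_id].
Qed.

Lemma tc_ball b (P : nat -> nat -> bool) : tc b -> tc2 (fun x i => P x i) ->
  tc (fun x => ball (b x) (P x)).
Proof.
move=> Hb HP; apply: (@tc_eq (fun x => ~~ bex (b x) (fun i => ~~ P x i))).
  by move=> x; rewrite /ball /bex has_predC negbK.
by apply: tc_negb; apply: tc_bex => //; apply: tc_negb.
Qed.

Ltac tc_step :=
  match goal with
  | H : tc ?f |- tc ?f => exact H
  | |- tc2 _ => rewrite /tc2 /=
  | |- tc3 _ => rewrite /tc3 /tc2 /=
  | |- tc4 _ => rewrite /tc4 /tc3 /tc2 /=
  | |- tc (fun _ => ?k) => exact (tc_const k)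
  | |- tc (fun x => x) => exact tc_id
  | |- tc fst_nat => exact (tc_fst tc_id)
  | |- tc snd_nat => exact (tc_snd tc_id)
  | |- tc (fun x => S (@?f x)) => apply (@tc_succ f)
  | |- tc (fun x => predn (@?f x)) => apply (@tc_pred f)
  | |- tc (fun x => fst_nat (@?f x)) => apply (@tc_fst f)
  | |- tc (fun x => snd_nat (@?f x)) => apply (@tc_snd f)
  | |- tc (fun x => pair_nat (@?f x) (@?g x)) => apply (@tc_pair f g)
  | |- tc (fun x => addn (@?f x) (@?g x)) => apply (@tc_add f g)
  | |- tc (fun x => subn (@?f x) (@?g x)) => apply (@tc_sub f g)
  | |- tc (fun x => muln (@?f x) (@?g x)) => apply (@tc_mul f g)
  | |- tc (fun x => expn (@?f x) (@?g x)) => apply (@tc_exp f g)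
  | |- tc (fun x => iteri (@?b x) (@?g x) (@?f x)) => apply (@tc_iteri b g f)
  | |- tc (fun x => if _ then _ else _) => apply: tc_if
  | |- tc (fun x => nat_of_bool (negb (@?f x))) => apply (@tc_negb f)
  | |- tc (fun x => nat_of_bool (andb (@?f x) (@?g x))) => apply (@tc_andb f g)
  | |- tc (fun x => nat_of_bool (orb (@?f x) (@?g x))) => apply (@tc_orb f g)
  | |- tc (fun x => nat_of_bool (if _ then _ else _)) => apply: tc_ifb
  | |- tc (fun x => nat_of_bool (leq (@?f x) (@?g x))) => apply (@tc_leq f g)
  | |- tc (fun x => nat_of_bool (odd (@?f x))) => apply (@tc_odd f)
  | |- tc (fun x => nat_of_bool (@eq_op _ (@?f x) (@?g x))) =>
       first [apply (@tc_eqn f g) | apply (@tc_eqb f g)]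
  | |- tc (fun x => nat_of_bool (bex (@?b x) (@?g x))) => apply (@tc_bex b g)
  | |- tc (fun x => nat_of_bool (ball (@?b x) (@?g x))) => apply (@tc_ball b g)
  | H : tc4 ?h |- tc (fun x => ?h (@?a x) (@?b x) (@?c x) (@?d x)) =>
       apply (@tc_app4 h a b c d H)
  | H : tc4 (fun y z u v => nat_of_bool (?h y z u v))
    |- tc (fun x => nat_of_bool (?h (@?a x) (@?b x) (@?c x) (@?d x))) =>
       apply (@tc_app4 (fun y z u v => nat_of_bool (h y z u v)) a b c d H)
  | H : tc3 ?h |- tc (fun x => ?h (@?a x) (@?b x) (@?c x)) =>
       apply (@tc_app3 h a b c H)
  | H : tc3 (fun y z u => nat_of_bool (?h y z u))
    |- tc (fun x => nat_of_bool (?h (@?a x) (@?b x) (@?c x))) =>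
       apply (@tc_app3 (fun y z u => nat_of_bool (h y z u)) a b c H)
  | H : tc2 ?h |- tc (fun x => ?h (@?a x) (@?b x)) =>
       apply (@tc_app2 h a b H)
  | H : tc2 (fun y z => nat_of_bool (?h y z))
    |- tc (fun x => nat_of_bool (?h (@?a x) (@?b x))) =>
       apply (@tc_app2 (fun y z => nat_of_bool (h y z)) a b H)
  | H : tc ?h |- tc (fun x => ?h (@?a x)) =>
       apply (@tc_comp h a H)
  | H : tc (fun y => nat_of_bool (?h y)) |- tc (fun x => nat_of_bool (?h (@?a x))) =>
       apply (@tc_comp (fun y => nat_of_bool (h y)) a H)
  end.

Ltac tc_auto := repeat (tc_step; cbv beta).

(** * A universal evaluation predicate *)

(** The length is kept apart from the data, so that every pair of numbers decodes to a list and no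
    well-formedness has to be tested. *)
Fixpoint seq_of len d :=
  if len is k.+1 then fst_nat d :: seq_of k (snd_nat d) else [::].

Lemma seq_of_surj (l : seq nat) : exists d, seq_of (size l) d = l.
Proof.
elim: l => [|x l [d Hd]]; first by exists 0.
by exists (pair_nat x d); rewrite /= !pairE Hd.
Qed.

Definition tails i d := iter i snd_nat d.

Lemma drop_seq_of i len d : drop i (seq_of len d) = seq_of (len - i) (tails i d).
Proof.
elim: i len d => [|i IH] [|len] d //=; rewrite IH subSS.
by rewrite /tails -iterSr.
Qed.

Lemma nth_seq_of i len d : i < len ->
  nth 0 (seq_of len d) i = fst_nat (tails i d).
Proof.
elim: i len d => [|i IH] [|len] d //=; rewrite ltnS => /IH ->.
by rewrite /tails -iterSr.
Qed.

Lemma size_seq_of len d : size (seq_of len d) = len.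
Proof. by elim: len d => //= len IH d; rewrite IH. Qed.

Lemma tc_tails f g : tc f -> tc g -> tc (fun x => tails (f x) (g x)).
Proof.
move=> Hf Hg; apply: (@tc_eq (fun x => iteri (f x) (fun _ z => snd_nat z) (g x))).
  by move=> x; rewrite /tails; elim: (f x) => //= k ->.
by tc_auto.
Qed.

Lemma tc_has P len d : tc2 (fun x u => P x u : bool) -> tc len -> tc d ->
  tc (fun x => has (P x) (seq_of (len x) (d x))).
Proof.
move=> HP Hlen Hd.
apply: (@tc_eq (fun x => bex (len x) (fun i => P x (fst_nat (tails i (d x)))))).
  move=> x; congr nat_of_bool; apply/bexP/(has_nthP 0).
    by move=> [i lt Pi]; exists i; rewrite ?size_seq_of ?nth_seq_of.
  move=> [i]; rewrite size_seq_of => lt; rewrite nth_seq_of // => Pi.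
  by exists i.
have Ht : tc2 tails by apply: tc_tails; tc_auto.
by tc_auto.
Qed.

Definition triple e n y := pair_nat e (pair_nat n y).

Fixpoint enc (c : code) : nat :=
  match c with
  | CZero => pair_nat 0 0
  | CSucc => pair_nat 1 0
  | CFst => pair_nat 2 0
  | CSnd => pair_nat 3 0
  | CPair f g => pair_nat 4 (pair_nat (enc f) (enc g))
  | CComp f g => pair_nat 5 (pair_nat (enc f) (enc g))
  | CRec f g => pair_nat 6 (pair_nat (enc f) (enc g))
  | CMu f => pair_nat 7 (enc f)
  end.

Lemma enc_inj : injective enc.
Proof.
elim=> [||||f IHf g IHg|f IHf g IHg|f IHf g IHg|f IHf]
  [||||f' g'|f' g'|f' g'|f'] //= /pair_inj [] // _.
- by move=> /pair_inj [/IHf -> /IHg ->].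
- by move=> /pair_inj [/IHf -> /IHg ->].
- by move=> /pair_inj [/IHf -> /IHg ->].
- by move=> /IHf ->.
Qed.

(* [t] codes a judgement [eval e n y] that follows in one step from those in [l]. *)
Definition justified (t : nat) (l : seq nat) : bool :=
  let e := fst_nat t in let n := fst_nat (snd_nat t) in
  let y := snd_nat (snd_nat t) in let tag := fst_nat e in let b := snd_nat e in
  let mem e n y := has (fun u => u == triple e n y) l in
  [|| (tag == 0) && (y == 0),
   (tag == 1) && (y == n.+1),
   (tag == 2) && (y == fst_nat n),
   (tag == 3) && (y == snd_nat n),
   [&& tag == 4, mem (fst_nat b) n (fst_nat y) & mem (snd_nat b) n (snd_nat y)],
   (tag == 5) && has (fun u => [&& fst_nat u == snd_nat b, fst_nat (snd_nat u) == n
     & mem (fst_nat b) (snd_nat (snd_nat u)) y]) l,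
   (tag == 6) && (if snd_nat n == 0 then mem (fst_nat b) (fst_nat n) y else
     has (fun u => [&& fst_nat u == e,
       fst_nat (snd_nat u) == pair_nat (fst_nat n) (snd_nat n).-1
       & mem (snd_nat b) (pair_nat (fst_nat n)
           (pair_nat (snd_nat n).-1 (snd_nat (snd_nat u)))) y]) l)
   | [&& tag == 7, mem b (pair_nat n y) 0 & ball y (fun i => has (fun u =>
     [&& fst_nat u == b, fst_nat (snd_nat u) == pair_nat n i
      & 0 < snd_nat (snd_nat u)]) l)]].

Fixpoint derivation (l : seq nat) : bool :=
  if l is t :: l' then justified t l' && derivation l' else true.

Lemma mem_triple e n y (l : seq nat) :
  has (fun u => u == triple e n y) l = (triple e n y \in l).
Proof. by rewrite -has_pred1. Qed.

Lemma tripleE u : triple (fst_nat u) (fst_nat (snd_nat u)) (snd_nat (snd_nat u)) = u.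
Proof. by rewrite /triple !pair_eta. Qed.

Lemma derivation_sound l : derivation l ->
  forall c n y, triple (enc c) n y \in l -> eval c n y.
Proof.
elim: l => //= t l IH /andP[just /IH{}IH] c n y.
rewrite inE => /predU1P [et|/IH //]; move: just; rewrite -{}et /justified !pairE.
case: c => [||||f g|f g|f g|f]; rewrite /= ?pairE /= ?orbF ?mem_triple.
- by move/eqP.
- by move/eqP.
- by move/eqP.
- by move/eqP.
- move=> /andP[/IH Hf /IH Hg]; exists (fst_nat y), (snd_nat y).
  by rewrite pair_eta.
- case/hasP=> u ul /and3P[/eqP e1 /eqP e2]; rewrite mem_triple => /IH Hf.
  by exists (snd_nat (snd_nat u)) => //; apply: IH; rewrite -e1 -e2 tripleE.
- case: (snd_nat n) => [/=|k /=]; first by move/IH.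
  case/hasP=> u ul /and3P[/eqP e1 /eqP e2]; rewrite mem_triple => /IH Hg.
  exists (snd_nat (snd_nat u)) => //.
  have : eval (CRec f g) (pair_nat (fst_nat n) k) (snd_nat (snd_nat u)).
    by apply: IH; rewrite /= -e1 -e2 tripleE.
  by rewrite /= !pairE.
- move=> /andP[/IH Hf /ballP Hb]; split=> // i /Hb /hasP [u ul].
  case/and3P=> /eqP e1 /eqP e2 pos; exists (snd_nat (snd_nat u)).-1.
  by apply: IH; rewrite prednK // -e1 -e2 tripleE.
Qed.

(** Every premise of a rule is looked up positively in the list, so further entries do no harm; this
    is what lets derivations be concatenated. *)
Lemma justified_sub t (l l' : seq nat) : {subset l <= l'} ->
  justified t l -> justified t l'.
Proof.
move=> sub.
have hs (P Q : pred nat) : {in l, forall x, P x -> Q x} -> has P l -> has Q l'.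
  by move=> PQ /hasP[x xl Px]; apply/hasP; exists x; [exact: sub|exact: PQ].
have hm e n y : has (fun u => u == triple e n y) l -> has (fun u => u == triple e n y) l'.
  by apply: hs.
rewrite /justified; do 4 (case/orP=> [->|]; first by rewrite ?orbT).
case/orP=> [/and3P[-> /hm -> /hm ->]|]; first by rewrite ?orbT.
case/orP=> [/andP[-> H]|].
  have -> : has (fun u => [&& fst_nat u == snd_nat (snd_nat (fst_nat t)),
    fst_nat (snd_nat u) == fst_nat (snd_nat t)
    & has (fun u0 => u0 == triple (fst_nat (snd_nat (fst_nat t))) (snd_nat (snd_nat u))
       (snd_nat (snd_nat t))) l']) l'; last by rewrite !orbT.
  by move: H; apply: hs => u _ /and3P[-> -> /hm ->].
case/orP=> [/andP[-> H]|].
  set b := (X in true && X); suff -> : b by rewrite !orbT.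
  move: H; rewrite /b; case: ifP => _; first exact: hm.
  by apply: hs => u _ /and3P[-> -> /hm ->].
case/and3P=> [-> /hm -> /ballP H].
set b := ball _ _; suff -> : b by rewrite !orbT.
by apply/ballP => i /H; apply: hs => u _ /and3P[-> -> ->].
Qed.

Lemma derivation_cat l l' : derivation l -> derivation l' -> derivation (l ++ l').
Proof.
move=> Hl Hl'; elim: l Hl => //= t l IH /andP[jt /IH ->]; rewrite andbT.
by apply: justified_sub jt => x; rewrite mem_cat => ->.
Qed.

Lemma derivation_complete c n y : eval c n y ->
  exists2 l, derivation l & triple (enc c) n y \in l.
Proof.
have add t l : derivation l -> justified t l ->
    exists2 l', derivation l' & t \in l'.
  by move=> Dl jt; exists (t :: l); rewrite ?inE ?eqxx //= jt.
elim: c n y => [||||f IHf g IHg|f IHf g IHg|f IHf g IHg|f IHf] n y /=.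
- by move=> ->; apply: (add _ [::]); rewrite // /justified !pairE.
- by move=> ->; apply: (add _ [::]); rewrite // /justified !pairE !eqxx.
- by move=> ->; apply: (add _ [::]); rewrite // /justified !pairE !eqxx.
- by move=> ->; apply: (add _ [::]); rewrite // /justified !pairE !eqxx.
- move=> [a [b [/IHf [l Dl il] /IHg [l' Dl' il'] ->]]].
  apply: (add _ (l ++ l')); first exact: derivation_cat.
  by rewrite /justified !pairE /= !mem_triple !mem_cat il il' ?orbT.
- move=> [m /IHg [l Dl il] /IHf [l' Dl' il']].
  apply: (add _ (l ++ l')); first exact: derivation_cat.
  rewrite /justified !pairE /= orbF; apply/hasP; exists (triple (enc g) n m).
    by rewrite mem_cat il.
  by rewrite !pairE !eqxx mem_triple mem_cat il' orbT.
- move: (pair_eta n); move: (fst_nat n) (snd_nat n) => a k <-{n}.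
  elim: k y => [|k IHk] y /=.
    move=> /IHf [l Dl il]; apply: (add _ l) => //.
    by rewrite /justified !pairE /= orbF mem_triple.
  move=> [z /IHk [l Dl il] /IHg [l' Dl' il']].
  apply: (add _ (l ++ l')); first exact: derivation_cat.
  rewrite /justified !pairE /= orbF; apply/hasP.
  exists (triple (enc (CRec f g)) (pair_nat a k) z); first by rewrite mem_cat il.
  by rewrite !pairE !eqxx mem_triple mem_cat il' orbT.
- move=> [/IHf [l Dl il] H].
  (* An unbounded search has one premise for each smaller argument; their derivations are merged
     into a single list. *)
  have [l' Dl' il'] : exists2 l', derivation l' &
     forall i, i < y -> exists z, triple (enc f) (pair_nat n i) z.+1 \in l'.
    elim: y H {l Dl il} => [|y IHy] H; first by exists [::].
    have [//|l Dl il] := IHy; first by move=> i lt; apply: H; apply: ltnW.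
    have [z /IHf [l' Dl' il']] := H y (ltnSn y).
    exists (l ++ l'); first exact: derivation_cat.
    move=> i; rewrite ltnS leq_eqVlt => /predU1P [->|/il [z' H']].
      by exists z; rewrite mem_cat il' orbT.
    by exists z'; rewrite mem_cat H'.
  apply: (add _ (l ++ l')); first exact: derivation_cat.
  rewrite /justified !pairE /= mem_triple mem_cat il /=; apply/ballP => i lt.
  have [z Hz] := il' i lt; apply/hasP; exists (triple (enc f) (pair_nat n i) z.+1).
    by rewrite mem_cat Hz orbT.
  by rewrite !pairE !eqxx.
Qed.

Definition derivation_code d := derivation (seq_of (fst_nat d) (snd_nat d)).

Definition evalT (e n y d : nat) : bool :=
  let l := seq_of (fst_nat d) (snd_nat d) in derivation_code d && has (fun u => u == triple e n y) l.

(** Kleene's normal form: halting with a given output amounts to the existence of some [d] that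
    passes a decidable test. *)
Lemma evalTP c n y : eval c n y <-> exists d, evalT (enc c) n y d.
Proof.
split=> [/derivation_complete [l Dl il]|[d /andP[Dl]]]; last first.
  by rewrite mem_triple; apply: derivation_sound.
have [d Hd] := seq_of_surj l; exists (pair_nat (size l) d).
by rewrite /evalT /derivation_code !pairE Hd Dl mem_triple.
Qed.

(** Recursion on the list becomes a bounded quantifier over its positions, a form to which the
    closure properties of [tc] apply. *)
Lemma derivation_drop l :
  derivation l = ball (size l) (fun i => justified (nth 0 l i) (drop i.+1 l)).
Proof.
elim: l => //= t l ->; rewrite /ball /= drop0; congr (_ && _).
by rewrite (iotaDl 1 0) all_map; apply: eq_all => i.
Qed.

Lemma tc_justified : tc3 (fun t len d => justified t (seq_of len d)).
Proof.
have Hm : tc4 (fun t len d u => has (fun v => v == u) (seq_of len d)).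
  by rewrite /tc4 /tc3 /tc2; apply: tc_has; tc_auto.
rewrite /justified /triple /tc3 /tc2 /=.
tc_auto; apply: tc_has; tc_auto; apply: tc_has; tc_auto.
Qed.

Lemma tc_derivation_code : tc (fun d => derivation_code d).
Proof.
apply: (@tc_eq (fun d => ball (fst_nat d) (fun i =>
   justified (fst_nat (tails i (snd_nat d)))
    (seq_of (fst_nat d - i.+1) (tails i.+1 (snd_nat d)))))).
  move=> d; congr nat_of_bool; rewrite /derivation_code derivation_drop size_seq_of.
  by apply/ballP/ballP => Hb i lt; move: (Hb i lt);
    rewrite nth_seq_of // drop_seq_of.
have Ht : tc2 tails by apply: tc_tails; tc_auto.
tc_auto; apply: (tc_app3 tc_justified); tc_auto.
Qed.

Lemma tc_evalT : tc4 (fun e n y d => evalT e n y d).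
Proof.
have Hd := tc_derivation_code; rewrite /evalT /triple.
by tc_auto; apply: tc_has; tc_auto.
Qed.

(** * Functions computable on a cohesive set *)

Lemma computable_bool A : computable A ->
  exists2 P : nat -> bool, tc (fun x => P x) & forall x, A x <-> P x.
Proof.
move=> [c Hc]; exists (fun x => `[< A x >]); last by move=> x; split=> /asboolP.
by exists c => n; case: asboolP; case: (Hc n).
Qed.

Lemma bool_computable (P : nat -> bool) A : tc (fun x => P x) ->
  (forall x, A x <-> P x) -> computable A.
Proof.
move=> [c Hc] HP; exists c => n; have := Hc n.
by case: (P n) (HP n) => -[h1 h2] e; split=> // An; [case: An; apply: h2|move: (h1 An)].
Qed.

Lemma ceP A : ce A <-> exists2 P : nat -> nat -> bool,
  tc2 (fun x y => P x y) & forall x, A x <-> exists y, P x y.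
Proof.
split=> [[B /computable_bool [P HP PB] AB]|[P HP AP]].
  exists (fun x y => ~~ P (pair_nat x y)); first by tc_auto.
  move=> x; rewrite AB; split=> -[y Hy]; exists y.
    by apply/negP => /PB; apply.
  by apply: contrapT => /PB; rewrite (negbTE Hy).
exists [set z | P (fst_nat z) (snd_nat z)].
  apply: (@bool_computable (fun z => ~~ P (fst_nat z) (snd_nat z))).
    by tc_auto.
  by move=> x; split=> /negP.
by move=> x; rewrite AP; split=> -[y Hy]; exists y; move: Hy; rewrite /= !pairE.
Qed.

Lemma sigma2P A : Sigma 2 A <-> exists2 P : nat -> nat -> nat -> bool,
  tc3 (fun x y z => P x y z) & forall x, A x <-> exists y, forall z, P x y z.
Proof.
split=> [[B /ceP [P HP PB] AB]|[P HP AP]].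
  exists (fun x y z => ~~ P (pair_nat x y) z); first by tc_auto.
  move=> x; rewrite AB; split=> -[y Hy]; exists y.
    by move=> z; apply/negP => h; have /PB : exists z, P (pair_nat x y) z by exists z.
  apply: contrapT => h; have /PB [z] := h.
  by rewrite (negbTE (Hy z)).
exists [set u | forall z, P (fst_nat u) (snd_nat u) z]; last first.
  move=> x; rewrite AP; split=> -[y Hy]; exists y; last by move: Hy; rewrite /= !pairE.
  by rewrite /= !pairE.
apply/ceP; exists (fun u z => ~~ P (fst_nat u) (snd_nat u) z); first by tc_auto.
move=> u; split=> [/existsNP [z /negP]|[z /negP h]]; first by exists z.
by move/(_ z).
Qed.

Definition ae (C : set nat) (P : nat -> Prop) :=
  exists N, forall n, N <= n -> C n -> P n.

Lemma almost_subsetP C (A : set nat) : almost_subset C A <-> ae C A.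
Proof.
split=> [/finite_seqP [l Hl]|[N HN]].
  have [N HN] : exists N, forall n, (C `\` A) n -> n < N.
    exists (\max_(i <- l) i).+1 => n; rewrite Hl /= ltnS => nl.
    exact: (@leq_bigmax_seq _ _ _ id).
  exists N => n le Cn; apply: contrapT => nA.
  by move: (HN n (conj Cn nA)); rewrite ltnNge le.
apply: (@sub_finite_set _ _ `I_N); last exact: finite_II.
by move=> n [Cn nA] /=; rewrite ltnNge; apply/negP => /HN /(_ Cn).
Qed.

Section AlmostEverywhere.
Variable C : set nat.

Lemma ae_all (P : nat -> Prop) : (forall n, P n) -> ae C P.
Proof. by exists 0. Qed.

Lemma ae_and (P Q : nat -> Prop) : ae C P -> ae C Q -> ae C (fun n => P n /\ Q n).
Proof.
move=> [N HN] [M HM]; exists (maxn N M) => n; rewrite geq_max => /andP[h1 h2] Cn.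
by split; [exact: HN|exact: HM].
Qed.

Lemma ae1 (P Q : nat -> Prop) : (forall n, P n -> Q n) -> ae C P -> ae C Q.
Proof. by move=> PQ [N HN]; exists N => n le Cn; apply: PQ; apply: HN. Qed.

Lemma ae2 (P1 P2 Q : nat -> Prop) :
  (forall n, P1 n -> P2 n -> Q n) -> ae C P1 -> ae C P2 -> ae C Q.
Proof. by move=> PQ h1 h2; apply: ae1 (ae_and h1 h2) => n [/PQ]; apply. Qed.

Lemma ae3 (P1 P2 P3 Q : nat -> Prop) :
  (forall n, P1 n -> P2 n -> P3 n -> Q n) -> ae C P1 -> ae C P2 -> ae C P3 -> ae C Q.
Proof.
by move=> PQ h1 h2 h3; apply: ae2 (ae_and h1 h2) h3 => n [a b]; apply: PQ.
Qed.

Lemma ae4 (P1 P2 P3 P4 Q : nat -> Prop) :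
  (forall n, P1 n -> P2 n -> P3 n -> P4 n -> Q n) ->
  ae C P1 -> ae C P2 -> ae C P3 -> ae C P4 -> ae C Q.
Proof.
move=> PQ h1 h2 h3 h4.
by apply: ae2 (ae_and h1 h2) (ae_and h3 h4) => n [a b] []; apply: PQ.
Qed.

Lemma ae_ltn_bounded (P : nat -> nat -> Prop) m :
  (forall i, i < m -> ae C (P i)) -> ae C (fun n => forall i, i < m -> P i n).
Proof.
elim: m => [|m IH] H; first exact: ae_all.
apply: ae2 (IH _) (H m _) => // [n h1 h2 i|i lt]; last by apply: H; apply: ltnW.
by rewrite ltnS leq_eqVlt => /predU1P [->|/h1].
Qed.

Hypothesis C_coh : cohesive C.

Lemma ae_exists (P : nat -> Prop) : ae C P -> exists2 n, C n & P n.
Proof.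
move=> [N HN]; apply: contrapT => h; case: C_coh => inf _; apply: inf.
apply: (@sub_finite_set _ _ `I_N); last exact: finite_II.
move=> n Cn /=; rewrite ltnNge; apply/negP => le; apply: h; exists n => //.
exact: HN.
Qed.

Lemma ae_False : ~ ae C (fun _ => False).
Proof. by move/ae_exists => -[]. Qed.

(* Such an [f] represents an element of a cohesive power over [C]. *)
Definition cpf (f : nat -> nat) := exists c, ae C (fun n => eval c n (f n)).

Lemma cpf_tc f : tc f -> cpf f.
Proof. by move=> [c Hc]; exists c; apply: ae_all. Qed.

Lemma cpf_comp g f : tc g -> cpf f -> cpf (fun n => g (f n)).
Proof.
by move=> [d Hd] [c Hc]; exists (CComp d c); apply: ae1 Hc => n /=; exists (f n).
Qed.

Lemma cpf_pair f g : cpf f -> cpf g -> cpf (fun n => pair_nat (f n) (g n)).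
Proof.
move=> [c Hc] [d Hd]; exists (CPair c d); apply: ae2 Hc Hd => n /= h1 h2.
by exists (f n), (g n).
Qed.

Lemma cpf_ae f g : ae C (fun n => f n = g n) -> cpf f -> cpf g.
Proof. by move=> h [c Hc]; exists c; apply: ae2 h Hc => n ->. Qed.

Lemma cpf_search f (D : nat -> nat -> bool) : cpf f -> tc2 (fun x y => D x y) ->
  ae C (fun n => exists y, D (f n) y) ->
  exists2 g, cpf g & ae C (fun n => D (f n) (g n)).
Proof.
move=> [c Hc] HD ex.
pose g n := if pselect (exists y, D (f n) y) is left e then ex_minn e else 0.
exists g; last first.
  apply: ae1 ex => n e; rewrite /g; case: pselect => // e'.
  by case: ex_minnP.
have [d Hd] : tc (fun u => ~~ D (fst_nat u) (snd_nat u)) by tc_auto.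
exists (CComp (CMu d) c); apply: ae2 ex Hc => n e Hf; exists (f n) => //=.
rewrite /g; case: pselect => // e'; case: ex_minnP => m Dm min; split.
  by have := Hd (pair_nat (f n) m); rewrite !pairE Dm.
move=> i lt; exists 0; have := Hd (pair_nat (f n) i); rewrite !pairE.
by case Di: (D _ i) => //; move: (min _ Di); rewrite leqNgt lt.
Qed.

(** The numbers on which the program of [f] halts with a value that has a witness form a c.e. set,
    and cohesiveness puts almost all of [C] on one side of it. *)
Lemma cpf_decide f (D : nat -> nat -> bool) : cpf f -> tc2 (fun x y => D x y) ->
  ae C (fun n => exists y, D (f n) y) \/ ae C (fun n => forall y, ~~ D (f n) y).
Proof.
move=> [c Hc] HD; have HT := tc_evalT.
have /C_coh.2 : ce [set n | exists2 x, eval c n x & exists y, D x y].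
  apply/ceP; exists (fun n u => evalT (enc c) n (fst_nat u) (fst_nat (snd_nat u))
       && D (fst_nat u) (snd_nat (snd_nat u))); first by tc_auto.
  move=> n; split=> [[x /evalTP [d Hd] [y Dy]]|[u /andP[Hd Dy]]].
    by exists (pair_nat x (pair_nat d y)); rewrite !pairE Hd.
  exists (fst_nat u); first by apply/evalTP; exists (fst_nat (snd_nat u)).
  by exists (snd_nat (snd_nat u)).
case=> /almost_subsetP H; [left|right].
  by apply: ae2 Hc H => n h1 /= [x /(eval_fun h1) <-].
apply: ae2 Hc H => n h1 /= h2 y; apply/negP => Dy; apply: h2.
by exists (f n) => //; exists y.
Qed.

Lemma cpf_decide_bool f (P : nat -> bool) : cpf f -> tc (fun x => P x) ->
  ae C (fun n => P (f n)) \/ ae C (fun n => ~~ P (f n)).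
Proof.
move=> cf HP; have HD : tc2 (fun x _ => P x) by tc_auto.
have [h|h] := cpf_decide cf HD; [left|right]; apply: ae1 h => n.
  by case.
by move/(_ 0).
Qed.

(** Each equation [f n = i] is decided almost everywhere. If all of them fail, those with [i <= k]
    fail simultaneously almost everywhere. *)
Lemma cpf_const_or_infty f : cpf f ->
  (exists k, ae C (fun n => f n = k)) \/ (forall k, ae C (fun n => k < f n)).
Proof.
move=> cf; case: (pselect (exists k, ae C (fun n => f n = k))); first by left.
move=> nex; right => k.
have H i : ae C (fun n => f n != i).
  have HD : tc (fun x => x == i) by tc_auto.
  have [h|//] := cpf_decide_bool cf HD.
  by case: nex; exists i; apply: ae1 h => n /eqP.
have := @ae_ltn_bounded (fun i n => f n != i) k.+1 (fun i _ => H i).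
by apply: ae1 => n h; rewrite ltnNge; apply/negP => /h /eqP.
Qed.

End AlmostEverywhere.

(** * Levels and active stages *)

Definition eventually (P : nat -> Prop) := ae setT P.

Lemma eventually_ae P : eventually P <-> exists N, forall n, N <= n -> P n.
Proof. by split=> -[N HN]; exists N => n le; [exact: HN|move=> _; exact: HN]. Qed.

(* [pi1 p x w] is the [p]-th co-c.e. relation, [pi1_at p s] its approximation
   at stage [s]. *)
Definition pi1 p x w : Prop :=
  forall d, ~~ evalT p (pair_nat x w) (fst_nat d) (snd_nat d).

Definition pi1_at p s x w : bool :=
  ball s (fun d => ~~ evalT p (pair_nat x w) (fst_nat d) (snd_nat d)).

Lemma pi1_limit p x w : eventually (fun s => pi1_at p s x w = `[< pi1 p x w >]).
Proof.
apply/eventually_ae; case: (pselect (pi1 p x w)) => h.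
  by exists 0 => s _; rewrite asboolT //; apply/ballP => d _; apply: h.
have /existsNP [d Hd] := h; exists d.+1 => s le; rewrite asboolF //.
by apply/negbTE/negP => /ballP /(_ d le).
Qed.

(* Cut the line into consecutive intervals, each one closed as soon as an
   element of the [Sigma_2] set [exists w, P _ w] is seen in it.  The state after
   [u] steps is the start of the current interval and the parity of its rank. *)
Definition cut_state (P : nat -> nat -> bool) u :=
  iteri u (fun k z =>
    if bex k.+1 (fun n => (fst_nat z <= n) && bex k.+1 (fun w => P n w))
    then pair_nat k.+1 (1 - snd_nat z) else z) (pair_nat 0 0).

Definition cut_start P u := fst_nat (cut_state P u).
Definition cut_parity P u := snd_nat (cut_state P u).

Lemma cut_parity_le1 P u : cut_parity P u <= 1.
Proof.
rewrite /cut_parity /cut_state; elim: u => [|u IH] /=; first by rewrite pairE.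
by case: ifP => // _; rewrite pairE leq_subr.
Qed.

(** The state does not move before the first step [k] at which an element of [J] from [u] on is seen
    together with its witness. So this element still has the parity of [u], and the next interval
    starts at [k.+1]. *)
Lemma cut_next (P : nat -> nat -> bool) (J : set nat) u : (forall N, exists2 n, N <= n & J n) ->
  (forall x, J x <-> exists w, P x w) -> cut_start P u = u ->
  (exists n, [/\ u <= n, J n & cut_parity P n = cut_parity P u]) /\
  exists2 u', u < u' & cut_start P u' = u' /\ cut_parity P u' = 1 - cut_parity P u.
Proof.
move=> infJ JP su.
pose cond k := bex k.+1 (fun n => (u <= n) && bex k.+1 (fun w => P n w)).
have stable k : u <= k -> (forall i, u <= i -> i < k -> ~~ cond i) ->
    cut_state P k = cut_state P u.
  elim: k => [|k IH]; first by rewrite leqn0 => /eqP ->.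
  rewrite leq_eqVlt => /predU1P [-> //|]; rewrite ltnS => le nc /=.
  have e : cut_state P k = cut_state P u.
    by apply: IH => // i ui ik; apply: nc => //; apply: ltnW.
  move: e; rewrite /cut_state /= => ->.
  rewrite -/(cut_state P u) -/(cut_start P u) su.
  by have /negbTE := nc k le (ltnSn k); rewrite /cond => ->.
have exc : exists k, (u <= k) && cond k.
  have [n un /JP [w Pnw]] := infJ u; exists (maxn n w).
  rewrite leq_max un /=; apply/bexP; exists n; first by rewrite ltnS leq_maxl.
  by rewrite un; apply/bexP; exists w => //; rewrite ltnS leq_maxr.
case: (ex_minnP exc) => k /andP[uk ck] kmin.
have nc i : u <= i -> i < k -> ~~ cond i.
  move=> ui ik; apply/negP => ci; have := kmin i; rewrite ui ci => /(_ isT).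
  by rewrite leqNgt ik.
split.
  have /bexP [n] := ck; rewrite ltnS => nk /andP[un /bexP [w _ Pnw]].
  exists n; split=> //; first by apply/JP; exists w.
  by rewrite /cut_parity stable // => i ui ni; apply: nc => //; apply: leq_trans nk.
exists k.+1; first by rewrite ltnS.
rewrite /cut_start /cut_parity /cut_state /= -/(cut_state P k) (stable k) //.
by rewrite -/(cut_start P u) su -/(cond k) ck !pairE.
Qed.

(** Beyond [N] there are two consecutive intervals; both contain elements of [J], and their parities
    differ. *)
Lemma cut_parity_splits (P : nat -> nat -> bool) (J : set nat) v N : (forall N, exists2 n, N <= n & J n) ->
  (forall x, J x <-> exists w, P x w) ->
  (forall x, N <= x -> J x -> cut_parity P x = v) -> False.
Proof.
move=> infJ JP par_v.
have [u Nu su] : exists2 u, N <= u & cut_start P u = u.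
  elim: N {par_v} => [|N [u Nu su]].
    by exists 0; rewrite // /cut_start /cut_state /= pairE.
  have [_ [u' uu' [su' _]]] := cut_next infJ JP su.
  by exists u' => //; apply: leq_trans uu'.
have [[n [un Jn pn]] [u' uu' [su' pu']]] := cut_next infJ JP su.
have [[n' [un' Jn' pn']] _] := cut_next infJ JP su'.
have e1 := par_v n (leq_trans Nu un) Jn.
have e2 := par_v n' (leq_trans Nu (leq_trans (ltnW uu') un')) Jn'.
move: pn'; rewrite pu' e2 -pn e1; by case: v {par_v e1 e2}.
Qed.

Definition parity_at p s u := cut_parity (pi1_at p s) u.
Definition parity_lim p u := cut_parity (fun x w => `[< pi1 p x w >]) u.

(** The first [u] steps of the cutting consult the relation only at arguments below [u], and these
    finitely many approximations settle. *)
Lemma parity_limit p u : eventually (fun s => parity_at p s u = parity_lim p u).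
Proof.
suff : eventually (fun s => cut_state (pi1_at p s) u
    = cut_state (fun x w => `[< pi1 p x w >]) u).
  by apply: ae1 => s; rewrite /parity_at /parity_lim /cut_parity => ->.
have H : eventually (fun s => forall n, n < u -> forall w, w < u ->
    pi1_at p s n w = `[< pi1 p n w >]).
  apply: (@ae_ltn_bounded _ (fun n s => forall w, w < u ->
    pi1_at p s n w = `[< pi1 p n w >])) => n _.
  apply: (@ae_ltn_bounded _ (fun w s => pi1_at p s n w = `[< pi1 p n w >])).
by move=> w _; apply: pi1_limit.
apply: ae1 H => s H.
suff : forall k, k <= u -> cut_state (pi1_at p s) k
    = cut_state (fun x w => `[< pi1 p x w >]) k by apply.
elim=> // k IH lt; have {}IH := IH (ltnW lt).
rewrite /cut_state /= in IH *; rewrite IH.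
set z := iteri k _ _; congr (if _ then _ else _).
apply/bexP/bexP => -[n nk /andP[zn /bexP [w wk Pw]]]; exists n => //;
  rewrite zn; apply/bexP; exists w => //; move: Pw; rewrite H //;
  exact: leq_trans lt.
Qed.

Lemma tc_parity_at : tc3 parity_at.
Proof.
have HT := tc_evalT; have Hp : tc4 (fun p s x w => pi1_at p s x w).
  by rewrite /pi1_at; tc_auto.
by rewrite /parity_at /cut_parity /cut_state; tc_auto.
Qed.

(** * The last active stages of the levels *)

Section ActiveStages.
Variable H : nat -> nat -> nat -> bool.
Hypothesis tcH : tc3 (fun c j s => H c j s).
Hypothesis H_limit : forall c j, exists b, eventually (fun s => H c j s = b).

(** Changes of availability count as well as changes of parity, so that the last active stage
    already shows the limits of [H]. Both searches stop at [j] to keep the active stages of a level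
    finite in number. *)
Definition active j s : bool :=
  [|| s == 0, bex j.+1 (fun p => parity_at p s j != parity_at p s.-1 j)
   | bex j.+1 (fun c => H c j s != H c j s.-1)].

Lemma tc_active : tc2 (fun j s => active j s).
Proof. by have Hp := tc_parity_at; rewrite /active; tc_auto. Qed.

Lemma active_bounded j : exists N, forall s, active j s -> s <= N.
Proof.
have Hc : eventually (fun s => forall c, c < j.+1 -> H c j s = H c j s.-1).
  apply: (@ae_ltn_bounded _ (fun c s => H c j s = H c j s.-1)) => c _.
  have [b /eventually_ae [N HN]] := H_limit c j.
  by exists N.+1 => -[//|s] le _; rewrite !HN //= ltnW.
have Hp : eventually (fun s => forall p, p < j.+1 ->
    parity_at p s j = parity_at p s.-1 j).
  apply: (@ae_ltn_bounded _ (fun p s => parity_at p s j = parity_at p s.-1 j)) => p _.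
  have /eventually_ae [N HN] := parity_limit p j.
  by exists N.+1 => -[//|s] le _; rewrite !HN //= ltnW.
have /eventually_ae [N HN] := ae_and Hc Hp; exists N => s.
case/or3P => [/eqP -> //|/bexP [p lt]|/bexP [c lt]]; apply: contraTT;
  rewrite -ltnNge => /ltnW /HN [h1 h2]; by rewrite ?h1 ?h2 // eqxx.
Qed.

Lemma inactive_stable j s s' : (forall t, s < t -> ~~ active j t) -> s <= s' ->
  (forall p, p <= j -> parity_at p s' j = parity_at p s j) /\
  (forall c, c <= j -> H c j s' = H c j s).
Proof.
move=> na; elim: s' => [|s' IH]; first by rewrite leqn0 => /eqP ->.
rewrite leq_eqVlt => /predU1P [-> //|le].
have nact := na _ le; rewrite ltnS in le.
have [IH1 IH2] := IH le; split=> i ij; rewrite -?IH1 -?IH2 //.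
  by apply/eqP; apply: contraNT nact => h; apply/or3P/Or32/bexP; exists i.
by apply/eqP; apply: contraNT nact => h; apply/or3P/Or33/bexP; exists i.
Qed.

(* The pairs (level, last active stage) have no [Sigma_2] cohesive subset. *)
Lemma later_active C f g : cohesive C -> Sigma 2 C -> cpf C f -> cpf C g ->
  (forall k, ae C (fun n => k < f n)) ->
  ae C (fun n => exists2 s, g n < s & active (f n) s).
Proof.
move=> coh /sigma2P [A tcA CA] cf cg finf.
have tca := tc_active.
have HD : tc2 (fun x s => (snd_nat x < s) && active (fst_nat x) s) by tc_auto.
have [h|h] := cpf_decide coh (cpf_pair cf cg) HD.
  by apply: ae1 h => n [s /andP[]]; rewrite !pairE => ? ?; exists s.
exfalso; have {h} last : ae C (fun n => forall s, g n < s -> ~~ active (f n) s).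
  by apply: ae1 h => n h s lt; move: (h s); rewrite !pairE lt.
have [c [N HN]] := cf.
(* [u] packs a number [n] beyond the threshold, a computation of [f n = x] and a Sigma_2 witness of
   [n] being in [C]; hence the image [J] is Sigma_2. *)
pose R x u z := [&& N <= fst_nat u,
  evalT (enc c) (fst_nat u) x (fst_nat (snd_nat u)) &
  A (fst_nat u) (snd_nat (snd_nat u)) z].
have tcR : tc (fun v => R (fst_nat (fst_nat v)) (snd_nat (fst_nat v)) (snd_nat v)).
  by have HT := tc_evalT; rewrite /R; tc_auto.
pose J : set nat := [set x | exists n, [/\ N <= n, C n & f n = x]].
have JR x : J x <-> exists u, forall z, R x u z.
  split=> [[n [Nn Cn fx]]|[u Hu]].
    have /evalTP [d Hd] := HN n Nn Cn; have /CA [y Hy] := Cn.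
    exists (pair_nat n (pair_nat d y)) => z; rewrite /R !pairE Nn -fx Hd.
    exact: Hy.
  have /and3P[Nn ev _] := Hu 0; exists (fst_nat u).
  have Cu : C (fst_nat u).
    by apply/CA; exists (snd_nat (snd_nat u)) => z; have /and3P[] := Hu z.
  split=> //; apply: (eval_fun (HN _ Nn Cu)); apply/evalTP.
  by exists (fst_nat (snd_nat u)).
(* The search for a failure of [R x u] diverges exactly when there is none, so [p] is an index of
   the co-c.e. relation that defines [J]. *)
have [d Hd] := tcR; pose p := enc (CMu d).
have pi1R x u : pi1 p x u <-> forall z, R x u z.
  split=> [h z|h e].
    apply: contrapT => nR.
    have ex : exists z, ~~ R x u z by exists z; apply/negP.
    case: (ex_minnP ex) => y nRy ymin.
    have /evalTP [e He] : eval (CMu d) (pair_nat x u) y.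
      split=> [|i lt].
        by have := Hd (pair_nat (pair_nat x u) y); rewrite !pairE (negbTE nRy).
      exists 0; have := Hd (pair_nat (pair_nat x u) i); rewrite !pairE.
      by case Ri: (R x u i) => //; move: (ymin i); rewrite Ri leqNgt lt => /(_ isT).
    by move: (h (pair_nat y e)); rewrite !pairE He.
  apply/negP => He.
  have [h0 _] : eval (CMu d) (pair_nat x u) (fst_nat e).
    by apply/evalTP; exists (snd_nat e).
  have := Hd (pair_nat (pair_nat x u) (fst_nat e)); rewrite !pairE h => h1.
  by have := eval_fun h0 h1.
(* Once [f n] exceeds [p], level [f n] watches parity [p]; with no active stage after [g n], the
   approximation at [g n] is the limit. *)
have parc : ae C (fun n => parity_at p (g n) (f n) = parity_lim p (f n)).
  apply: ae2 last (finf p) => n na lt.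
  have /eventually_ae [M HM] := parity_limit p (f n).
  have [st _] := inactive_stable na (leq_maxl (g n) M).
  by rewrite -(st p (ltnW lt)) HM // leq_maxr.
have cpar : cpf C (fun n => parity_at p (g n) (f n)).
  have HP : tc (fun x => parity_at p (fst_nat x) (snd_nat x)).
    by have Hp := tc_parity_at; tc_auto.
  by have := cpf_comp HP (cpf_pair cg cf); under eq_fun do rewrite !pairE.
have [[v parv]|gt1] := cpf_const_or_infty coh cpar; last first.
  apply: (ae_False coh); apply: ae1 (gt1 1) => n.
  by rewrite ltnNge cut_parity_le1.
have [M HM] := ae_and parc parv.
(* The finitely many [n] below [M] contribute only values below [K], so an element of [J] from [K]
   on stems from a later [n]. *)
have [K HK] : exists K, forall n, n < M -> f n < K.
  elim: M {HM} => [|M [K HK]]; first by exists 0.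
  exists (maxn K (f M).+1) => n; rewrite ltnS leq_eqVlt leq_max.
  by case/predU1P => [->|/HK ->] //; rewrite ltnSn orbT.
apply: (@cut_parity_splits (fun x w => `[< pi1 p x w >]) J v K).
- move=> L; have geN : ae C (fun n => N <= n) by exists N.
  have [n Cn [Nn Lf]] := ae_exists coh (ae_and geN (finf L)).
  by exists (f n); [exact: ltnW|exists n].
- by move=> x; rewrite JR; split=> -[u Hu]; exists u; [apply/asboolP/pi1R|
    apply/pi1R/asboolP].
- move=> x Kx [n [Nn Cn fx]].
  have [Mn|/HK] := leqP M n; last by rewrite fx ltnNge Kx.
  by have [h1 h2] := HM n Mn Cn; rewrite -h2 h1 fx.
Qed.

End ActiveStages.

(** * Linear orders *)

Definition linear (A : order_str) :=
  [/\ forall x : A, ~ prec x x,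
      forall x y z : A, prec x y -> prec y z -> prec x z
    & forall x y : A, [\/ prec x y, x = y | prec y x]].

(** The embedding stands for an isomorphism of [B] with the suborder [P]; pieces of an order are
    handled as predicates, without subtypes. *)
Definition part (B A : order_str) (P : A -> Prop) :=
  exists f : B -> A, [/\ forall x y, prec x y -> prec (f x) (f y),
    forall x, P (f x) & forall a, P a -> exists x, f x = a].

Lemma part_iso (A B : order_str) : linear A -> linear B ->
  @part B A (fun _ => True) -> iso A B.
Proof.
move=> [irr tr tot] [irrB trB totB] [f [mono _ surj]].
pose g a := projT1 (cid (surj a I)).
have gK a : f (g a) = a by rewrite /g; case: (cid _).
have mono' x y : prec (f x) (f y) -> prec x y.
  move=> h; case: (totB x y) => // [e|/mono h'].
    by case: (irr (f y)); rewrite {1}e in h.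
  by case: (irr _ (tr _ _ _ h h')).
have finj x y : f x = f y -> x = y.
  by move=> e; case: (totB x y) => // /mono; rewrite e => /irr.
exists g; first by exists f => // x; apply: finj; rewrite gK.
move=> x y; split=> [h|/mono]; last by rewrite !gK.
by apply: mono'; rewrite !gK.
Qed.

Lemma part_ext (A B : order_str) (P Q : A -> Prop) :
  (forall a, P a <-> Q a) -> @part B A P -> @part B A Q.
Proof.
move=> PQ [f [h1 h2 h3]]; exists f; split=> // [x|a /PQ]; last exact: h3.
exact/PQ.
Qed.

Lemma part_plus (A B1 B2 : order_str) (P1 P2 : A -> Prop) :
  part B1 P1 -> part B2 P2 -> (forall x y, P1 x -> P2 y -> prec x y) ->
  part (plus B1 B2) (fun x => P1 x \/ P2 x).
Proof.
move=> [f [mf Pf sf]] [g [mg Pg sg]] lt.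
exists (fun u => match u with inl x => f x | inr y => g y end); split.
- by move=> [x|x] [y|y] //=; [apply: mf|move=> _; apply: lt|apply: mg].
- by move=> [x|x]; [left|right].
- move=> a [/sf|/sg] [x <-]; first by exists (inl x).
  by exists (inr x).
Qed.

Lemma part_order_sum (A I : order_str) (F : I -> order_str) (P : A -> Prop)
    (Q : I -> A -> Prop) :
  (forall i, part (F i) (Q i)) ->
  (forall i j x y, prec i j -> Q i x -> Q j y -> prec x y) ->
  (forall x, P x <-> exists i, Q i x) -> part (order_sum F) P.
Proof.
move=> pF lt PQ; pose f i := projT1 (cid (pF i)).
have Hf i : [/\ forall x y, prec x y -> prec (f i x) (f i y),
    forall x, Q i (f i x) & forall a, Q i a -> exists x, f i x = a].
  by rewrite /f; case: (cid _).
exists (fun u => f (projT1 u) (projT2 u)); split.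
- move=> u v; case=> [i j x y ij|i x y xy] /=.
    by apply: lt ij _ _; [case: (Hf i)|case: (Hf j)].
  by case: (Hf i) => h _ _; apply: h.
- by move=> [i x] /=; apply/PQ; exists i; case: (Hf i).
- move=> a /PQ [i Qa]; case: (Hf i) => _ _ /(_ a Qa) [x <-].
  by exists (existT _ i x).
Qed.

Lemma linear_plus A B : linear A -> linear B -> linear (plus A B).
Proof.
move=> [irA trA toA] [irB trB toB]; split.
- by move=> [x|x] /=.
- by move=> [x|x] [y|y] [z|z] //=; [apply: trA|apply: trB].
- move=> [x|x] [y|y] /=; try by [constructor 1|constructor 3].
    by case: (toA x y) => h; [constructor 1|constructor 2; rewrite h|constructor 3].
  by case: (toB x y) => h; [constructor 1|constructor 2; rewrite h|constructor 3].
Qed.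

Lemma linear_order_sum (I : order_str) (F : I -> order_str) :
  linear I -> (forall i, linear (F i)) -> linear (order_sum F).
Proof.
move=> [irI trI toI] HF.
(* Inversion of [lex] leaves an equation between indices, along which the second component is
   transported; proof irrelevance removes it when the indices coincide. *)
have inv (u v : order_sum F) : prec u v -> prec (projT1 u) (projT1 v) \/
    exists e : projT1 u = projT1 v, prec (eq_rect _ F (projT2 u) _ e) (projT2 v).
  case=> [i j x y ij|i x y xy]; first by left.
  by right; exists erefl.
split.
- move=> [i x] /inv /= [/irI //|[e]].
  by rewrite (Prop_irrelevance e erefl) /=; case: (HF i) => ir _ _ /ir.
- move=> [i x] [j y] [k z] /inv /= [ij|[e]].
    move=> /inv /= [jk|[e _]]; first by constructor; apply: trI jk.
    by constructor; rewrite -e.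
  case: _ / e y => y /= xy /inv /= [ik|[e]]; first by constructor.
  case: _ / e z => z /= yz; apply: lex_fibre; case: (HF i) => _ tr _.
  exact: tr yz.
- move=> [i x] [j y]; case: (toI i j) => [ij|e|ji].
  + by constructor 1; constructor.
  + case: _ / e y => y; case: (HF i) => _ _ /(_ x y) [h|->|h].
    * by constructor 1; apply: lex_fibre.
    * by constructor 2.
    * by constructor 3; apply: lex_fibre.
  + by constructor 3; constructor.
Qed.

Lemma linear_omega : linear omega.
Proof.
split=> [x|x y z|x y] /=; first by rewrite ltnn.
  exact: ltn_trans.
by case: (ltngtP x y) => h; [constructor 1|constructor 3|constructor 2].
Qed.

Lemma linear_eta : linear eta.
Proof.
split=> [x|x y z|x y] /=; first by rewrite Order.POrderTheory.ltxx.
  exact: Order.POrderTheory.lt_trans.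
by case: (Order.TotalTheory.ltgtP x y) => h;
  [constructor 1|constructor 3|constructor 2].
Qed.

Lemma linear_fin n : linear (fin_order n).
Proof.
split=> [x|x y z|x y] /=; first by rewrite ltnn.
  exact: ltn_trans.
case: (ltngtP x y) => h; [constructor 1|constructor 3|constructor 2] => //.
exact: val_inj.
Qed.

Lemma linear_zeta : linear zeta.
Proof.
split=> [x|x y z|x y] /=; first by rewrite Order.POrderTheory.ltxx.
  exact: Order.POrderTheory.lt_trans.
by case: (Order.TotalTheory.ltgtP x y) => h;
  [constructor 1|constructor 3|constructor 2].
Qed.

Lemma linear_reverse A : linear A -> linear (reverse A).
Proof.
move=> [ir tr to]; split=> [x|x y z h1 h2|x y] /=; first exact: ir.
  exact: tr h1.
by case: (to x y) => h; [constructor 3|constructor 2|constructor 1].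
Qed.

(** * Cantor's theorem for dense weak orders *)

Section BackAndForth.

(* Density modulo incomparability, so that no quotient has to be formed. *)
Record dense_weak (T : Type) (lt : T -> T -> Prop) : Prop := DenseWeak {
  dw_irr : forall x, ~ lt x x;
  dw_trans : forall x y z, lt x y -> lt y z -> lt x z;
  dw_split : forall x y z, lt x z -> lt x y \/ lt y z;
  dw_dense : forall x y, lt x y -> exists2 z, lt x z & lt z y;
  dw_up : forall x, exists y, lt x y;
  dw_down : forall x, exists y, lt y x }.

(** By [dw_split], a bound for a maximal element of [lo] or a minimal one of [hi] also bounds the
    elements incomparable with it, so one use of density or unboundedness suffices. *)
Lemma dense_between (T : Type) (lt : T -> T -> Prop) (t0 : T) (lo hi : seq T) :
  dense_weak lt -> (forall a b, List.In a lo -> List.In b hi -> lt a b) ->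
  exists x, (forall a, List.In a lo -> lt a x) /\ (forall b, List.In b hi -> lt x b).
Proof.
move=> dw.
have tops (l : seq T) : l = [::] \/
    exists2 m, List.In m l & forall a, List.In a l -> ~ lt m a.
  elim: l => [|x l [->|[m ml Hm]]]; [by left| |]; right.
    by exists x => [|a [<-|//]]; [left|exact: dw_irr dw x].
  case: (pselect (lt m x)) => mx; [exists x|exists m]; rewrite /=; auto.
    move=> a [<-|al]; first exact: dw_irr dw x.
    by move=> xa; apply: (Hm a al); apply: dw_trans dw _ _ _ mx xa.
  by move=> a [<-|al]; auto.
have bots (l : seq T) : l = [::] \/
    exists2 m, List.In m l & forall a, List.In a l -> ~ lt a m.
  elim: l => [|x l [->|[m ml Hm]]]; [by left| |]; right.
    by exists x => [|a [<-|//]]; [left|exact: dw_irr dw x].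
  case: (pselect (lt x m)) => mx; [exists x|exists m]; rewrite /=; auto.
    move=> a [<-|al]; first exact: dw_irr dw x.
    by move=> xa; apply: (Hm a al); apply: dw_trans dw _ _ _ xa mx.
  by move=> a [<-|al]; auto.
have low m x a : ~ lt m a -> lt m x -> lt a x.
  by move=> na mx; case: (dw_split dw a mx).
have high m x b : ~ lt b m -> lt x m -> lt x b.
  by move=> nb xm; case: (dw_split dw b xm).
case: (tops lo) => [->|[m ml Hm]]; case: (bots hi) => [->|[m' ml' Hm']] H.
- by exists t0.
- by have [x xm] := dw_down dw m'; exists x; split=> // b /Hm' nb; apply: high xm.
- by have [x xm] := dw_up dw m; exists x; split=> // a /Hm na; apply: low xm.
- have [x mx xm] := dw_dense dw (H _ _ ml ml'); exists x; split.
    by move=> a /Hm na; apply: low mx.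
  by move=> b /Hm' nb; apply: high xm.
Qed.

Definition partial_iso (S T : Type) (ltS : S -> S -> Prop) (ltT : T -> T -> Prop)
    (l : seq (S * T)) :=
  forall p q, List.In p l -> List.In q l -> ltS p.1 q.1 <-> ltT p.2 q.2.

Lemma partial_iso_extend (S T : Type) ltS ltT (t0 : T) (l : seq (S * T)) :
  dense_weak ltS -> dense_weak ltT -> partial_iso ltS ltT l ->
  forall s, exists t, partial_iso ltS ltT ((s, t) :: l).
Proof.
move=> dS dT pl s.
suff [t Ht] : exists t, forall p, List.In p l ->
    (ltS p.1 s <-> ltT p.2 t) /\ (ltS s p.1 <-> ltT t p.2).
  exists t => p q /= [<-|pl'] [<-|ql'] /=.
  - by split=> [/(dw_irr dS)|/(dw_irr dT)].
  - exact: (Ht q ql').2.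
  - exact: (Ht p pl').1.
  - exact: pl.
(* A point incomparable with an earlier one can share its image. Otherwise it lies strictly between
   the points of [l] below it and those above it. *)
case: (pselect (exists2 p, List.In p l & ~ ltS p.1 s /\ ~ ltS s p.1)).
  case=> p pin [n1 n2]; exists p.2 => q ql.
  rewrite -(pl _ _ pin ql) -(pl _ _ ql pin); split; split=> h.
  - by case: (dw_split dS p.1 h).
  - by case: (dw_split dS s h).
  - by case: (dw_split dS p.1 h).
  - by case: (dw_split dS s h).
move=> ncomp.
have comp p : List.In p l -> ltS p.1 s \/ ltS s p.1.
  move=> pin; case: (pselect (ltS p.1 s)) => h1; first by left.
  case: (pselect (ltS s p.1)) => h2; first by right.
  by case: ncomp; exists p.
pose lo := [seq p.2 | p <- l & `[< ltS p.1 s >]].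
pose hi := [seq p.2 | p <- l & `[< ltS s p.1 >]].
have Inlo a : List.In a lo <-> exists2 p, List.In p l & ltS p.1 s /\ p.2 = a.
  rewrite /lo; elim: (l) => [|p l' IH] /=; first by split=> // -[].
  case: asboolP => h /=; rewrite IH; split.
  - by case=> [<-|[p' ? ?]]; [exists p; auto|exists p'; auto].
  - by case=> p' [<- [_ ?]|? ?]; [left|right; exists p'].
  - by case=> p' ? ?; exists p'; auto.
  - by case=> p' [<- []//|? ?]; exists p'.
have Inhi a : List.In a hi <-> exists2 p, List.In p l & ltS s p.1 /\ p.2 = a.
  rewrite /hi; elim: (l) => [|p l' IH] /=; first by split=> // -[].
  case: asboolP => h /=; rewrite IH; split.
  - by case=> [<-|[p' ? ?]]; [exists p; auto|exists p'; auto].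
  - by case=> p' [<- [_ ?]|? ?]; [left|right; exists p'].
  - by case=> p' ? ?; exists p'; auto.
  - by case=> p' [<- []//|? ?]; exists p'.
have [t [Hlo Hhi]] : exists x, (forall a, List.In a lo -> ltT a x) /\
    (forall b, List.In b hi -> ltT x b).
  apply: dense_between => // a b /Inlo [p pin [ps <-]] /Inhi [q qin [sq <-]].
  by apply/pl => //; apply: dw_trans dS _ _ _ ps sq.
have asym x y : ltT x y -> ~ ltT y x.
  by move=> h h'; apply: (dw_irr dT (dw_trans dT h h')).
have asymS x y : ltS x y -> ~ ltS y x.
  by move=> h h'; apply: (dw_irr dS (dw_trans dS h h')).
exists t => p pin; case: (comp p pin) => h.
  have pt : ltT p.2 t by apply: Hlo; apply/Inlo; exists p.
  by split; split=> // h'; [case: (asymS _ _ h)|case: (asym _ _ pt)].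
have tp : ltT t p.2 by apply: Hhi; apply/Inhi; exists p.
by split; split=> // h'; [case: (asymS _ _ h)|case: (asym _ _ tp)].
Qed.

Lemma partial_iso_sym (S T : Type) ltS ltT (l : seq (S * T)) :
  partial_iso ltS ltT l -> partial_iso ltT ltS [seq (p.2, p.1) | p <- l].
Proof.
have sw p : List.In p [seq (p.2, p.1) | p <- l] -> List.In (p.2, p.1) l.
  elim: l => //= q l IH [<-|/IH]; last by right.
  by left; case: q.
by move=> pl p q /sw pin /sw qin; rewrite -(pl _ _ pin qin).
Qed.

Lemma dense_weak_rat : dense_weak (fun x y : rat => (x < y)%R).
Proof.
split.
- by move=> x; rewrite Order.POrderTheory.ltxx.
- by move=> x y z; apply: Order.POrderTheory.lt_trans.
- move=> x y z xz; case: (Order.TotalTheory.ltP x y) => [|yx]; first by left.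
  by right; apply: Order.POrderTheory.le_lt_trans yx xz.
- move=> x y xy; exists ((x + y) / 2)%R.
    by rewrite Num.Theory.midf_lt.
  by rewrite Num.Theory.midf_lt.
- by move=> x; exists (x + 1)%R; rewrite Num.Theory.ltrDl.
- by move=> x; exists (x - 1)%R; rewrite Num.Theory.gtrBl.
Qed.

(** Back and forth between the rationals, enumerated by [unpickle], and [T], enumerated by [e].
    Incomparable points of [T] share a rational, hence the form of the surjectivity claim. *)
Lemma cantor_rat (T : Type) (lt : T -> T -> Prop) (e : nat -> T) :
  dense_weak lt -> (forall x, exists n, e n = x) ->
  exists r : rat -> T, (forall a b, (a < b)%R -> lt (r a) (r b)) /\
    forall x, exists q, ~ lt x (r q) /\ ~ lt (r q) x.
Proof.
move=> dT esurj; pose ltQ (x y : rat) : Prop := (x < y)%R.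
have dQ : dense_weak ltQ := dense_weak_rat.
pose good (l : seq (rat * T)) := partial_iso ltQ lt l.
have ext n (l : {l | good l}) : exists l' : {l | good l},
    [/\ forall p, List.In p (sval l) -> List.In p (sval l'),
        exists t, List.In (odflt 0%R (unpickle n), t) (sval l')
      & exists q, List.In (q, e n) (sval l')].
  case: l => l gl /=.
  (* Numbers that code no rational are read as 0, and a rational may be treated repeatedly. Later on
     one of its images is chosen. *)
  have [t g1] := partial_iso_extend (e 0) dQ dT gl (odflt 0%R (unpickle n)).
  have [q g2] := partial_iso_extend 0%R dT dQ (partial_iso_sym g1) (e n).
  have g3 := partial_iso_sym g2.
  rewrite /= -map_comp (@eq_map _ _ _ id) in g3; last by case.
  rewrite map_id in g3; exists (exist _ _ g3); split=> /=.
  - by move=> p; auto.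
  - by exists t; auto.
  - by exists q; auto.
have g0 : good [::] by [].
pose step n l := projT1 (cid (ext n l)).
pose L n := iteri n step (exist _ [::] g0).
have Lmono n m p : n <= m -> List.In p (sval (L n)) -> List.In p (sval (L m)).
  move=> + pn; elim: m => [|m IH]; first by rewrite leqn0 => /eqP <-.
  rewrite leq_eqVlt => /predU1P [<- //|]; rewrite ltnS => /IH.
  by rewrite [L m.+1]/= /step; case: (cid _) => l' [h _ _] /=; apply: h.
have LQ q : exists t n, List.In (q, t) (sval (L n)).
  have : exists t, List.In (odflt 0%R (unpickle (pickle q)), t) (sval (L (pickle q).+1)).
    by rewrite [L _.+1]/= /step; case: (cid _) => l' [].
  by rewrite pickleK => -[t]; exists t, (pickle q).+1.
have LT x : exists q n, List.In (q, x) (sval (L n)).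
  have [n <-] := esurj x.
  have : exists q, List.In (q, e n) (sval (L n.+1)).
    by rewrite [L _.+1]/= /step; case: (cid _) => l' [].
  by move=> [q]; exists q, n.+1.
have LL n m q x q' x' : List.In (q, x) (sval (L n)) -> List.In (q', x') (sval (L m)) ->
    (ltQ q q' <-> lt x x').
  move=> h1 h2; have := svalP (L (maxn n m)).
  move/(_ (q, x) (q', x')); apply; first by apply: Lmono h1; rewrite leq_maxl.
  by apply: Lmono h2; rewrite leq_maxr.
pose r q := projT1 (cid (LQ q)).
have Hr q : exists n, List.In (q, r q) (sval (L n)) by rewrite /r; case: (cid _).
exists r; split.
  by move=> a b; have [n Hn] := Hr a; have [m Hm] := Hr b; move/(LL _ _ _ _ _ _ Hn Hm).
move=> x; have [q [n Hn]] := LT x; exists q; have [m Hm] := Hr q.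
split.
  by move/(LL _ _ _ _ _ _ Hn Hm); exact: (dw_irr dQ).
by move/(LL _ _ _ _ _ _ Hm Hn); exact: (dw_irr dQ).
Qed.

End BackAndForth.

(** The classes of [E] are convex, and modulo [E] the order is countable and dense without
    endpoints, so Cantor's theorem indexes the classes by the rationals. This serves both for finite
    distance inside an infinite block and for the nonstandard blocks themselves. *)
Lemma part_dense_sum (A : order_str) (P : A -> Prop) (E : A -> A -> Prop)
    (typ : A -> order_str) (e : nat -> A) :
  linear A ->
  (forall x, P x -> E x x) ->
  (forall x y, E x y -> [/\ P x, P y & E y x]) ->
  (forall x y z, E x y -> E y z -> E x z) ->
  (forall x y z, P y -> E x z -> prec x y -> prec y z -> E x y) ->
  (forall x, P x -> exists n, e n = x) ->
  (exists x, P x) ->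
  (forall x y, P x -> P y -> prec x y -> ~ E x y ->
     exists z, [/\ P z, prec x z /\ ~ E x z & prec z y /\ ~ E z y]) ->
  (forall x, P x -> exists y, [/\ P y, prec x y & ~ E x y]) ->
  (forall x, P x -> exists y, [/\ P y, prec y x & ~ E y x]) ->
  (forall x, P x -> part (typ x) (E x)) ->
  exists r : rat -> A, [/\ forall q, P (r q),
    part (order_sum (fun q : eta => typ (r q))) P,
    forall a b, (a < b)%R -> prec (r a) (r b) /\ ~ E (r a) (r b)
    & forall x, P x -> exists q, E x (r q)].
Proof.
move=> [ir tr to] Erefl Esym Etr Econv ecount [x0 Px0] dense up down typE.
pose T := {x : A | P x}; pose lt (x y : T) := prec (sval x) (sval y) /\ ~ E (sval x) (sval y).
have prec_E x y z : prec x y -> ~ E x y -> E y z -> P x -> prec x z.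
  move=> xy nE yz Px; case: (to x z) => // [xz|zx].
    by case: nE; rewrite xz; case: (Esym _ _ yz).
  by case: nE; case: (Esym _ _ yz) => _ _ zy; have := Econv _ _ _ Px zy zx xy;
    move=> zEx; case: (Esym _ _ (Etr _ _ _ yz zEx)).
have E_prec x y z : prec x y -> ~ E x y -> E x z -> P y -> prec z y.
  move=> xy nE xz Py; case: (to z y) => // [zy|yz].
    by case: nE; rewrite -zy.
  by case: nE; apply: Econv Py xz xy yz.
have dw : dense_weak lt.
  split.
  - by move=> x [/ir].
  - move=> [x Px] [y Py] [z Pz] [/= xy nxy] [/= yz nyz]; split=> /=.
      exact: tr yz.
    by move=> xz; apply: nxy; apply: Econv Py xz xy yz.
  - move=> [x Px] [y Py] [z Pz] [/= xz nxz]; rewrite /lt /=.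
    case: (pselect (E x y)) => xy.
      right; split; first exact: E_prec xz nxz xy Pz.
      by move=> yz; apply: nxz; apply: Etr yz.
    case: (to x y) => [h|h|h]; first by left.
      by case: xy; rewrite -h; apply: Erefl.
    right; split; first exact: tr xz.
    move=> yz; apply: xy; have yx := Econv _ _ _ Px yz h xz.
    by case: (Esym _ _ yx).
  - move=> [x Px] [y Py] [/= xy nxy]; have [z [Pz xz zy]] := dense x y Px Py xy nxy.
    by exists (exist _ z Pz).
  - by move=> [x Px]; have [y [Py xy nxy]] := up x Px; exists (exist _ y Py).
  - by move=> [x Px]; have [y [Py xy nxy]] := down x Px; exists (exist _ y Py).
pose e' n : T := if pselect (P (e n)) is left h then exist _ (e n) h else exist _ x0 Px0.
have [|r [rmono ronto]] := cantor_rat (e := e') dw.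
  move=> [x Px]; have [n en] := ecount x Px; exists n; rewrite /e'.
  by case: pselect => [h|]; [apply: eq_exist|rewrite en].
have ronto' x : P x -> exists q, E x (sval (r q)).
  move=> Px; have [q] := ronto (exist _ x Px); rewrite /lt /= => -[n1 n2]; exists q.
  case: (to x (sval (r q))) => [h|<-|h]; last 2 first.
  - exact: Erefl.
  - case: (pselect (E (sval (r q)) x)) => [/Esym [] //|nE].
    by case: n2.
  - by case: (pselect (E x (sval (r q)))) => // nE; case: n1.
exists (fun q => sval (r q)); split=> // [q|]; first exact: svalP.
apply: (part_order_sum (Q := fun (q : eta) x => E (sval (r q)) x)).
- by move=> q; apply: typE; exact: svalP.
- move=> q q' x y /rmono [h nE] qx qy; case: (Esym _ _ qx) => _ Px _.
  case: (Esym _ _ qy) => _ Py _.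
  apply: prec_E qy Px; first exact: E_prec h nE qx (svalP _).
  move=> xq; apply: nE; exact: Etr xq.
- move=> x; split=> [/ronto' [q /Esym [_ _ h]]|[q /Esym [] //]].
  by exists q.
Qed.

(** Finite initial segments yield least elements, hence a first element and successors. An element
    missed by iterating the successor would have too many predecessors. *)
Lemma omega_enumeration (D : nat -> Prop) (lt : nat -> nat -> Prop) :
  (forall x y, lt x y -> D x) ->
  (forall x, ~ lt x x) -> (forall x y z, lt x y -> lt y z -> lt x z) ->
  (forall x y, D x -> D y -> [\/ lt x y, x = y | lt y x]) ->
  (forall x, D x -> exists N, forall y, lt y x -> y <= N) ->
  (forall N, exists2 x, N < x & D x) ->
  exists g : nat -> nat, [/\ forall n, D (g n), forall n m, n < m -> lt (g n) (g m)
    & forall x, D x -> exists n, g n = x].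
Proof.
move=> ltD ir tr to bnd unb.
have wf_min (Q : nat -> Prop) : (forall x, Q x -> D x) -> (exists x, Q x) ->
    exists2 x, Q x & forall y, Q y -> y = x \/ lt x y.
  move=> QD [x Qx]; have [N HN] := bnd x (QD x Qx).
  (* Counting predecessors replaces well-founded induction. Since [N] bounds the predecessors of
     [x], the count is exact for [x] and everything before it. *)
  pose rk y := count (fun z => `[< lt z y >]) (iota 0 N.+1).
  have rk_lt y z : lt y z -> (lt z x \/ z = x) -> rk y < rk z.
    move=> yz zx; have yx : lt y x by case: zx => [|<- //]; apply: tr.
    have : y \in iota 0 N.+1 by rewrite mem_iota ltnS HN.
    rewrite /rk; elim: (iota 0 N.+1) => //= a l IH; rewrite inE.
    have sub : count (fun t => `[< lt t y >]) l <= count (fun t => `[< lt t z >]) l.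
      by apply: sub_count => t /= /asboolP h; apply/asboolP; apply: tr yz.
    have hd : `[< lt a y >] <= `[< lt a z >].
      by case: asboolP => // h; rewrite asboolT //; apply: tr yz.
    case/predU1P => [<-|/IH h]; last by rewrite -addnS leq_add.
    by rewrite asboolF // asboolT // add0n add1n ltnS.
  have ex : exists n, `[< exists y, [/\ Q y, lt y x \/ y = x & rk y = n] >].
    by exists (rk x); apply/asboolP; exists x; split=> //; right.
  case: (ex_minnP ex) => n /asboolP [y [Qy yx rky]] nmin; exists y => // z Qz.
  case: (to z y (QD _ Qz) (QD _ Qy)) => [zy|->|]; [|by left|by right].
  have : n <= rk z.
    apply: nmin; apply/asboolP; exists z; split=> //; left.
    by case: yx => [|<- //]; apply: tr.
  by rewrite -rky leqNgt rk_lt.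
have [m0 Dm0 min0] : exists2 x, D x & forall y, D y -> y = x \/ lt x y.
  by apply: wf_min => //; have [x _ Dx] := unb 0; exists x.
have nxt (x : {x | D x}) : exists x' : {x | D x}, lt (sval x) (sval x') /\
    forall y, lt (sval x) y -> D y -> y = sval x' \/ lt (sval x') y.
  case: x => x Dx /=; have [x' [Dx' xx'] minx'] :
      exists2 y, D y /\ lt x y & forall z, D z /\ lt x z -> z = y \/ lt y z.
    apply: wf_min => [y []//|]; have [N HN] := bnd x Dx.
    have [y Ny Dy] := unb (maxn N x); exists y; split=> //.
    move: Ny; rewrite gtn_max => /andP[Ny xy].
    case: (to x y Dx Dy) => // [e|/HN]; last by rewrite leqNgt Ny.
    by rewrite e ltnn in xy.
  by exists (exist _ x' Dx'); split=> //= y h1 h2; apply: minx'.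
pose G n := iter n (fun x => projT1 (cid (nxt x))) (exist _ m0 Dm0).
pose g n := sval (G n).
have gS n : lt (g n) (g n.+1) /\ forall y, lt (g n) y -> D y -> y = g n.+1 \/ lt (g n.+1) y.
  by rewrite /g [G n.+1]/=; case: (cid _).
have gmono n m : n < m -> lt (g n) (g m).
  elim: m => // m IH; rewrite ltnS leq_eqVlt => /predU1P [->|/IH h].
    by case: (gS m).
  by apply: tr h _; case: (gS m).
exists g; split=> // [n|x Dx]; first exact: svalP.
apply: contrapT => nex; have gx n : lt (g n) x.
  elim: n => [|n IH].
    by case: (min0 x Dx) => // e; case: nex; exists 0; rewrite e.
  case: (gS n) => _ /(_ x IH Dx) [e|//]; by case: nex; exists n.+1.
have [N HN] := bnd x Dx.
(* Pigeonhole: [N.+2] distinct predecessors of [x] would lie among the [N.+1] numbers up to [N]. *)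
have : size [seq g i | i <- iota 0 N.+2] <= size (iota 0 N.+1).
  apply: uniq_leq_size.
    rewrite map_inj_uniq ?iota_uniq // => i j e.
    case: (ltngtP i j) => // /gmono; rewrite e => /ir [].
  by move=> _ /mapP [i _ ->]; rewrite mem_iota add0n ltnS HN.
by rewrite size_map !size_iota ltnn.
Qed.

(** * Cohesive powers as orders of functions *)

Section PowerGerms.
Variables (L : computable_linear_order) (C : set nat).
Hypothesis C_coh : cohesive C.
Let T := cohesive_power L C.

Lemma lt_bool : exists2 D : nat -> nat -> bool, tc2 (fun x y => D x y) &
  forall x y, clo_lt L x y <-> D x y.
Proof.
have [P HP LP] := computable_bool (clo_lt_computable L).
exists (fun x y => P (pair_nat x y)); first by tc_auto.
by move=> x y; rewrite -LP /= !pairE.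
Qed.

Lemma power_choice (K : T) : exists2 phi, cp_fun L C phi & sval K = cp_class L C phi.
Proof. exact: svalP K. Qed.

Definition power_fun (K : T) : pfun := sval (cid2 (power_choice K)).

Lemma power_funP (K : T) :
  cp_fun L C (power_fun K) /\ sval K = cp_class L C (power_fun K).
Proof. by rewrite /power_fun; case: (cid2 _). Qed.

Definition rep (K : T) n := odflt 0 (power_fun K n).

Lemma rep_some (K : T) : ae C (fun n => power_fun K n = Some (rep K n)).
Proof.
have [[_ _ /almost_subsetP H] _] := power_funP K; apply: ae1 H => n /=.
by rewrite /rep; case: (power_fun K n).
Qed.

Lemma rep_cpf (K : T) : cpf C (rep K).
Proof.
have [[[c Hc] _ _] _] := power_funP K; exists c.
by apply: ae1 (rep_some K) => n /Hc.
Qed.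

Lemma rep_dom (K : T) : ae C (fun n => clo_dom L (rep K n)).
Proof.
have [[_ Hd _] _] := power_funP K.
by apply: ae1 (rep_some K) => n /Hd.
Qed.

Lemma cp_eqP phi psi : cp_eq C phi psi <->
  ae C (fun n => exists x, phi n = Some x /\ psi n = Some x).
Proof. exact: almost_subsetP. Qed.

Lemma power_prec (K K' : T) :
  prec K K' <-> ae C (fun n => clo_lt L (rep K n) (rep K' n)).
Proof.
have [cK eK] := power_funP K; have [cK' eK'] := power_funP K'.
split=> [[phi [psi [h1 h2 /almost_subsetP lt]]]|lt].
  rewrite eK in h1; rewrite eK' in h2; case: h1 => _ /cp_eqP h1.
  case: h2 => _ /cp_eqP h2; apply: ae4 lt h1 h2 (ae_and (rep_some K) (rep_some K')).
  move=> n /= [x [y [px py xy]]] [x' [ex px']] [y' [ey py']] [e1 e2].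
  move: px px' py py' e1 e2; rewrite ex ey => -> [<-] -> [<-] [<-] [<-].
  exact: xy.
exists (power_fun K), (power_fun K'); split.
- rewrite eK; split=> //; apply/cp_eqP; apply: ae1 (rep_some K) => n e.
  by exists (rep K n).
- rewrite eK'; split=> //; apply/cp_eqP; apply: ae1 (rep_some K') => n e.
  by exists (rep K' n).
- apply/almost_subsetP; apply: ae3 lt (rep_some K) (rep_some K') => n lt e1 e2.
  by exists (rep K n), (rep K' n).
Qed.

Lemma rep_inj (K K' : T) : ae C (fun n => rep K n = rep K' n) -> K = K'.
Proof.
move=> h; suff e : sval K = sval K'.
  by case: K K' e {h} => [K HK] [K' HK'] /= e; apply: eq_exist.
have [cK ->] := power_funP K; have [cK' ->] := power_funP K'.
have {}h : ae C (fun n => power_fun K n = power_fun K' n).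
  by apply: ae3 h (rep_some K) (rep_some K') => n + -> -> => ->.
apply/seteqP; split=> psi [cpsi /cp_eqP e]; split=> //; apply/cp_eqP.
  by apply: ae2 h e => n ->.
by apply: ae2 h e => n ->.
Qed.

Lemma rep_surj f : cpf C f -> ae C (fun n => clo_dom L (f n)) ->
  exists K : T, ae C (fun n => rep K n = f n).
Proof.
move=> [c Hc] df.
have [P HP LP] := computable_bool (clo_dom_computable L).
have [d Hd] : tc (fun v => ~~ P (fst_nat v)) by tc_auto.
have [i Hi] := tc_id.
have evalP y : (exists m, eval (CMu d) y m) <-> P y.
  split=> [[m /= [h0 _]]|Py].
    have := eval_fun h0 (Hd (pair_nat y m)); rewrite pairE.
    by case: (P y).
  by exists 0; split=> //; have := Hd (pair_nat y 0); rewrite pairE Py.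
(* The program of [f] may leave the domain outside [C] or at finitely many points of it. A search
   that halts only on members of the domain is appended, and its result discarded, so that the
   program diverges there instead. *)
pose c' := CComp (CComp CFst (CPair i (CMu d))) c.
have evc n y : eval c' n y <-> eval c n y /\ P y.
  split=> [[m ecm /= [_ [a [b [/(eval_fun (Hi m)) <- eb ->]]] ->]]|[ey Py]].
    by rewrite fst_pair; split=> //; apply/evalP; exists b.
  have [m em] := (evalP y).2 Py; exists y => //.
  exists (pair_nat y m); last by rewrite /= fst_pair.
  by exists y, m; split=> //; apply: Hi.
pose phi n := if pselect (exists y, eval c' n y) is left e then Some (sval (cid e)) else None.
have phiP n y : phi n = Some y <-> eval c' n y.
  rewrite /phi; case: pselect => [e|ne]; last first.
    by split=> // h; case: ne; exists y.
  case: (cid e) => z ez /=; split=> [[<-] //|ey]; congr Some.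
  exact: eval_fun ez ey.
have cphi : cp_fun L C phi.
  split; first by exists c'.
    by move=> n y /phiP /evc [_ /LP].
  apply/almost_subsetP; apply: ae2 Hc df => n ev /LP Pf /=.
  by have -> : phi n = Some (f n) by apply/phiP/evc.
exists (exist _ (cp_class L C phi) (ex_intro2 _ _ phi cphi erefl)).
set K : T := exist _ _ _; have [cK eK] := power_funP K.
have : cp_class L C phi (power_fun K).
  have -> : cp_class L C phi = sval K by [].
  rewrite eK; split=> //; apply/cp_eqP; apply: ae1 (rep_some K) => n e.
  by exists (rep K n).
case=> _ /cp_eqP h; apply: ae4 h Hc df (rep_some K) => n [x [/phiP /evc [ex _] e2]] ev _ e3.
by move: e2; rewrite e3 => -[->]; apply: eval_fun ex ev.
Qed.

Lemma linear_power : linear T.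
Proof.
have [D tcD LD] := lt_bool.
split.
- move=> K /power_prec h; apply: (ae_False C_coh); apply: ae1 h => n.
  exact: clo_irrefl.
- move=> K1 K2 K3 /power_prec h1 /power_prec h2; apply/power_prec.
  by apply: ae2 h1 h2 => n; apply: clo_trans.
- move=> K K'.
  have cp := cpf_pair (rep_cpf K) (rep_cpf K').
  have t1 : tc (fun u => D (fst_nat u) (snd_nat u)) by tc_auto.
  have t2 : tc (fun u => D (snd_nat u) (fst_nat u)) by tc_auto.
  have [h|n1] := cpf_decide_bool C_coh cp t1.
    constructor 1; apply/power_prec; apply: ae1 h => n; rewrite !pairE.
    by move=> /LD.
  have [h|n2] := cpf_decide_bool C_coh cp t2.
    constructor 3; apply/power_prec; apply: ae1 h => n; rewrite !pairE.
    by move=> /LD.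
  constructor 2; apply: rep_inj.
  apply: ae4 n1 n2 (rep_dom K) (rep_dom K') => n; rewrite !pairE => n1 n2 d d'.
  by case: (clo_total d d') => // /LD h; [rewrite h in n1|rewrite h in n2].
Qed.

(** Distinct elements cannot share a program, so choosing an element for each program code
    enumerates the power. *)
Lemma power_countable : exists e : nat -> T, forall K, exists n, e n = K.
Proof.
have [x0 dx0] := clo_nonempty L.
have [K0 _] : exists K : T, ae C (fun n => rep K n = x0).
  by apply: rep_surj; [apply/cpf_tc/tc_const|apply: ae_all].
pose Q n (K : T) := exists2 c, enc c = n & ae C (fun m => eval c m (rep K m)).
exists (fun n => if pselect (exists K, Q n K) is left h then sval (cid h) else K0).
move=> K; have [c Hc] := rep_cpf K; exists (enc c).
case: pselect => [h|[]]; last by exists K, c.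
case: (cid h) => K' /= [c' /enc_inj -> Hc']; apply: rep_inj.
by apply: ae2 Hc Hc' => n h1 h2; apply: eval_fun h2 h1.
Qed.

End PowerGerms.

(** * Cohesive powers of finite orders *)

Definition big_type : order_str := plus (plus omega zeta_eta) (reverse omega).

Lemma linear_big_type : linear big_type.
Proof.
apply: linear_plus; last exact/linear_reverse/linear_omega.
apply: linear_plus; first exact: linear_omega.
by apply: linear_order_sum => [|_]; [exact: linear_eta|exact: linear_zeta].
Qed.

Lemma cpf2 C (h : nat -> nat -> nat) f g : tc2 h -> cpf C f -> cpf C g ->
  cpf C (fun n => h (f n) (g n)).
Proof.
move=> Hh cf cg; have := cpf_comp Hh (cpf_pair cf cg).
by under eq_fun do rewrite !pairE.
Qed.

Lemma cpf_decide2 C (D : nat -> nat -> bool) f g : cohesive C ->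
  tc2 (fun x y => D x y) -> cpf C f -> cpf C g ->
  ae C (fun n => D (f n) (g n)) \/ ae C (fun n => ~~ D (f n) (g n)).
Proof.
move=> coh HD cf cg; have HD' : tc (fun u => D (fst_nat u) (snd_nat u)) by [].
by have [h|h] := cpf_decide_bool coh (cpf_pair cf cg) HD'; [left|right];
  apply: ae1 h => n; rewrite !pairE.
Qed.

Lemma cpf_half C f : cpf C f -> cpf C (fun n => (f n)./2).
Proof.
move=> cf; have HD : tc2 (fun x y => (x == y + y) || (x == (y + y).+1)) by tc_auto.
have [|g cg Hg] := cpf_search cf HD.
  apply: ae_all => n; exists (f n)./2; rewrite addnn.
  by rewrite -{1 3}(odd_double_half (f n)); case: odd; rewrite ?eqxx ?orbT.
apply: cpf_ae cg; apply: ae1 Hg => n; rewrite addnn.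
by case/orP=> /eqP ->; rewrite /= ?uphalf_double ?doubleK.
Qed.

(* The suborder [Q] of [T] is a cohesive power of the finite orders of size
   [sigma n], [rk] being the rank within them. *)
Section Ranks.
Variables (C : set nat) (T : order_str) (Q : T -> Prop).
Variables (rk : T -> nat -> nat) (sigma : nat -> nat) (e : nat -> T).
Hypotheses (C_coh : cohesive C) (T_lin : linear T).
Hypothesis e_surj : forall K, exists n, e n = K.
Hypothesis sigma_cpf : cpf C sigma.
Hypothesis rk_cpf : forall K, Q K -> cpf C (rk K).
Hypothesis rk_lt : forall K, Q K -> ae C (fun n => rk K n < sigma n).
Hypothesis rk_mono : forall K K', Q K -> Q K' ->
  ae C (fun n => rk K n < rk K' n) -> prec K K'.
Hypothesis rk_inj : forall K K', Q K -> Q K' ->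
  ae C (fun n => rk K n = rk K' n) -> K = K'.
Hypothesis rk_surj : forall f, cpf C f -> ae C (fun n => f n < sigma n) ->
  exists2 K, Q K & ae C (fun n => rk K n = f n).

Lemma rk_prec K K' : Q K -> Q K' -> prec K K' -> ae C (fun n => rk K n < rk K' n).
Proof.
move=> QK QK' KK'; have [irr tr _] := T_lin.
have HD : tc2 (fun x y => x < y) by tc_auto.
have [//|n1] := cpf_decide2 C_coh HD (rk_cpf QK) (rk_cpf QK').
have [h|n2] := cpf_decide2 C_coh HD (rk_cpf QK') (rk_cpf QK).
  by case: (irr K); apply: tr KK' _; apply: rk_mono.
case: (irr K); rewrite {2}(rk_inj QK QK') //; apply: ae2 n1 n2 => n.
by rewrite -!leqNgt => h1 h2; apply/eqP; rewrite eqn_leq h1 h2.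
Qed.

Lemma part_fin k : ae C (fun n => sigma n = k) -> part (fin_order k) Q.
Proof.
move=> sk.
have ex (i : 'I_k) : exists2 K, Q K & ae C (fun n => rk K n = i).
  apply: rk_surj; first exact/cpf_tc/tc_const.
  by apply: ae1 sk => n ->.
exists (fun i => sval (cid2 (ex i))); split=> [i j ij|i|K QK].
- case: (cid2 (ex i)) => K QK rK; case: (cid2 (ex j)) => K' QK' rK' /=.
  by apply: rk_mono => //; apply: ae2 rK rK' => n -> ->.
- by case: (cid2 _).
- have [[i ri]|inf] := cpf_const_or_infty C_coh (rk_cpf QK).
    have [n _ [[eqn lt] e2]] := ae_exists C_coh (ae_and (ae_and ri (rk_lt QK)) sk).
    have ik : i < k by rewrite -eqn -e2.
    exists (Ordinal ik); case: (cid2 _) => K' QK' rK' /=.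
    by apply: rk_inj => //; apply: ae2 ri rK' => m -> ->.
  case: (ae_False C_coh); apply: ae3 sk (rk_lt QK) (inf k) => n -> h1 h2.
  by have := ltn_trans h1 h2; rewrite ltnn.
Qed.

Section Infinite.
Hypothesis sigma_infty : forall k, ae C (fun n => k < sigma n).

(** The three summands of [big_type]: ranks at finite distance from the left end, from the right
    end, and from neither. *)
Let low K := Q K /\ exists k, ae C (fun n => rk K n = k).
Let high K := Q K /\ exists k, ae C (fun n => rk K n + k.+1 = sigma n).
Let mid K := [/\ Q K, forall k, ae C (fun n => k < rk K n)
  & forall k, ae C (fun n => rk K n + k < sigma n)].

Lemma tc2_sub : tc2 subn. Proof. by tc_auto. Qed.
Lemma tc2_add : tc2 addn. Proof. by tc_auto. Qed.

Lemma rank_cases K : Q K <-> (low K \/ mid K) \/ high K.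
Proof.
split=> [QK|]; last by case=> [[] []|[]].
have [rc|rinf] := cpf_const_or_infty C_coh (rk_cpf QK); first by left; left.
have [[k sc]|sinf] := cpf_const_or_infty C_coh (cpf2 tc2_sub sigma_cpf (rk_cpf QK)).
  right; split=> //; exists k.-1; apply: ae2 sc (rk_lt QK) => n <- lt.
  by rewrite prednK ?subn_gt0 // subnKC // ltnW.
left; right; split=> // k; apply: ae2 (sinf k) (rk_lt QK) => n.
by rewrite ltn_subRL.
Qed.

Lemma part_low : part omega low.
Proof.
have ex (k : nat) : exists2 K, Q K & ae C (fun n => rk K n = k).
  by apply: rk_surj => //; exact/cpf_tc/tc_const.
exists (fun k => sval (cid2 (ex k))); split=> [i j ij|i|K [QK [k rKk]]].
- case: (cid2 (ex i)) => K QK rK; case: (cid2 (ex j)) => K' QK' rK' /=.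
  by apply: rk_mono => //; apply: ae2 rK rK' => n -> ->.
- by case: (cid2 _) => K QK rK; split=> //; exists i.
- exists k; case: (cid2 _) => K' QK' rK' /=.
  by apply: rk_inj => //; apply: ae2 rKk rK' => m -> ->.
Qed.

Lemma part_high : part (reverse omega) high.
Proof.
have ex (k : nat) : exists2 K, Q K & ae C (fun n => rk K n = sigma n - k.+1).
  apply: rk_surj; first by apply: cpf2 tc2_sub sigma_cpf _; exact/cpf_tc/tc_const.
  by apply: ae1 (sigma_infty k) => n lt; rewrite ltn_subrL /= (leq_trans _ lt).
exists (fun k => sval (cid2 (ex k))); split=> [i j ij|i|K [QK [k rKk]]].
- case: (cid2 (ex i)) => K QK rK; case: (cid2 (ex j)) => K' QK' rK' /=.
  apply: rk_mono => //; apply: ae3 rK rK' (sigma_infty i) => n -> -> lt.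
  by move: ij lt => /=; lia.
- case: (cid2 _) => K QK rK /=; split=> //; exists i.
  by apply: ae2 rK (sigma_infty i) => n -> lt; rewrite subnK.
- exists k; case: (cid2 _) => K' QK' rK' /=.
  by apply: rk_inj => //; apply: ae2 rKk rK' => m <- ->; rewrite addnK.
Qed.

Let near K K' := [/\ mid K, mid K'
  & exists k, ae C (fun n => rk K n <= rk K' n + k /\ rk K' n <= rk K n + k)].

(** Subtraction is truncated, but the ranks in [mid] exceed every constant almost everywhere. *)
Let shift (x : nat) (z : int) := match z with Posz m => x + m | Negz m => x - m.+1 end.

Lemma tc_shift z : tc (fun x => shift x z).
Proof. by case: z => m /=; tc_auto. Qed.

Lemma part_near K : mid K -> part zeta (near K).
Proof.
move=> mK; have [QK Kinf Ksup] := mK.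
have ex z : exists2 K', Q K' & ae C (fun n => rk K' n = shift (rk K n) z).
  apply: rk_surj; first exact: cpf_comp (tc_shift z) (rk_cpf QK).
  case: z => m /=; first exact: Ksup.
  by apply: ae1 (rk_lt QK) => n; apply: leq_ltn_trans; rewrite leq_subr.
have nearE z K' : Q K' -> ae C (fun n => rk K' n = shift (rk K n) z) -> near K K'.
  move=> QK' rK'; split=> //; last first.
    exists (match z with Posz m => m | Negz m => m.+1 end).
    by case: z rK' => m rK'; apply: ae1 rK' => n -> /=; lia.
  split=> // k; case: z rK' => m rK' /=.
  - by apply: ae2 rK' (Kinf k) => n -> /leq_trans; apply; rewrite leq_addr.
  - by apply: ae2 rK' (Kinf (m.+1 + k)) => n ->; rewrite ltn_subRL.
  - by apply: ae2 rK' (Ksup (m + k)) => n ->; rewrite addnA.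
  - apply: ae2 rK' (Ksup k) => n ->; apply: leq_ltn_trans.
    by rewrite leq_add2r leq_subr.
exists (fun z => sval (cid2 (ex z))); split=> [z z' lt|z|K' [_ mK' [k HK']]].
- case: (cid2 (ex z)) => K1 Q1 r1; case: (cid2 (ex z')) => K2 Q2 r2 /=.
  apply: rk_mono => //.
  (* Room for both shifts, so that neither subtraction is truncated. *)
  have h0 : ae C (fun n => `|z|%N + `|z'|%N < rk K n) by apply: Kinf.
  apply: ae3 r1 r2 h0 => n -> ->.
  by move: z z' lt => [m|m] [m'|m'] //=; rewrite ?ssrint.NegzE; lia.
- by case: (cid2 _) => K' QK' rK' /=; apply: nearE rK'.
- have [QK' _ _] := mK'.
  have bounded f b : cpf C f -> ae C (fun n => f n <= b) -> exists v, ae C (fun n => f n = v).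
    move=> cf fb; have [//|inf] := cpf_const_or_infty C_coh cf.
    case: (ae_False C_coh); apply: ae2 fb (inf b) => n h1 h2.
    by have := leq_trans h2 h1; rewrite ltnn.
  have [a Ha] : exists v, ae C (fun n => rk K n - rk K' n = v).
    apply: (bounded _ k); first exact: cpf2 tc2_sub (rk_cpf QK) (rk_cpf QK').
    by apply: ae1 HK' => n [h _]; rewrite leq_subLR.
  have [b Hb] : exists v, ae C (fun n => rk K' n - rk K n = v).
    apply: (bounded _ k); first exact: cpf2 tc2_sub (rk_cpf QK') (rk_cpf QK).
    by apply: ae1 HK' => n [_ h]; rewrite leq_subLR.
  (* One of the constants [a] and [b] is 0, being the two truncated differences of the same numbers;
     [Negz a'] stands for [- a'.+1]. *)
  exists (match a with 0 => Posz b | a'.+1 => Negz a' end).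
  case: (cid2 _) => K1 Q1 r1 /=; apply: rk_inj => //.
  by apply: ae3 r1 Ha Hb => n ->; case: a => [|a'] /=; lia.
Qed.

Lemma mid_of_rank f : cpf C f -> (forall k, ae C (fun n => k < f n)) ->
  (forall k, ae C (fun n => f n + k < sigma n)) ->
  exists2 K, mid K & ae C (fun n => rk K n = f n).
Proof.
move=> cf finf fsup; have [|K QK rK] := rk_surj cf.
  by apply: ae1 (fsup 0) => n; rewrite addn0.
exists K => //; split=> // k; first by apply: ae2 rK (finf k) => n ->.
by apply: ae2 rK (fsup k) => n ->.
Qed.

(** Midpoints: halving an infinite gap between two ranks leaves two infinite gaps, and doing so with
    0 or [sigma] as one end shows that no class is first or last. *)
Lemma part_mid : part zeta_eta mid.
Proof.
have not_near K K' : mid K -> mid K' -> prec K K' -> ~ near K K' ->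
    forall k, ae C (fun n => rk K n + k < rk K' n).
  move=> mK mK' KK' nE; have [QK _ _] := mK; have [QK' _ _] := mK'.
  have lt := rk_prec QK QK' KK'.
  have [[k Hk]|inf] := cpf_const_or_infty C_coh (cpf2 tc2_sub (rk_cpf QK') (rk_cpf QK)).
    by case: nE; split=> //; exists k; apply: ae2 lt Hk => n; lia.
  by move=> k; apply: ae1 (inf k) => n; rewrite ltn_subRL.
have far K K' : ae C (fun n => rk K n < rk K' n) ->
    (forall k, ae C (fun n => rk K n + k < rk K' n)) -> mid K -> mid K' ->
    prec K K' /\ ~ near K K'.
  move=> lt fr [QK _ _] [QK' _ _]; split; first exact: rk_mono.
  by case=> _ _ [k Hk]; apply: (ae_False C_coh); apply: ae2 Hk (fr k) => n; lia.
have mean_cpf f g : cpf C f -> cpf C g -> cpf C (fun n => (f n + g n)./2).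
  by move=> cf cg; apply: cpf_half; apply: cpf2 tc2_add cf cg.
have [|||||||||||r []] // := @part_dense_sum T mid near (fun _ => zeta) e.
- by move=> K mK; split=> //; exists 0; apply: ae_all => n; rewrite addn0.
- move=> K K' [mK mK' [k Hk]]; split=> //; split=> //; exists k.
  by apply: ae1 Hk => n [].
- move=> K1 K2 K3 [m1 _ [k Hk]] [_ m3 [l Hl]]; split=> //; exists (k + l).
  by apply: ae2 Hk Hl => n; lia.
- move=> K1 K2 K3 m2 [m1 m3 [k Hk]] /rk_prec h1 /rk_prec h2; split=> //.
  have [Q1 _ _] := m1; have [Q2 _ _] := m2; have [Q3 _ _] := m3.
  exists k; apply: ae3 Hk (h1 Q1 Q2) (h2 Q2 Q3) => n; lia.
- have [|k|k|K mK _] := mid_of_rank (f := fun n => (sigma n)./2).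
  + exact: cpf_half.
  (* With [(k + k).+2] as margin each half exceeds [k] in spite of rounding; the same margin recurs
     below. *)
  + by apply: ae1 (sigma_infty (k + k).+2) => n; lia.
  + by apply: ae1 (sigma_infty (k + k).+2) => n; lia.
  by exists K.
- move=> K K' mK mK' KK' /(not_near _ _ mK mK' KK') fr.
  have [QK inf _] := mK; have [QK' _ sup] := mK'.
  have [|k|k|K2 m2 r2] := mid_of_rank (f := fun n => (rk K n + rk K' n)./2).
  + by apply: mean_cpf; apply: rk_cpf.
  + by apply: ae2 (inf k) (fr 0) => n; lia.
  + by apply: ae2 (sup k) (fr 0) => n; lia.
  exists K2; split=> //; apply: far => // [|k].
  + by apply: ae2 r2 (fr 2) => n ->; lia.
  + by apply: ae2 r2 (fr (k + k).+2) => n ->; lia.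
  + by apply: ae2 r2 (fr 2) => n ->; lia.
  + by apply: ae2 r2 (fr (k + k).+2) => n ->; lia.
- move=> K mK; have [QK inf sup] := mK.
  have [|k|k|K2 m2 r2] := mid_of_rank (f := fun n => (rk K n + sigma n)./2).
  + by apply: mean_cpf => //; apply: rk_cpf.
  + by apply: ae2 (inf k) (sup 0) => n; lia.
  + by apply: ae1 (sup (k + k).+2) => n; lia.
  have [h1 h2] : prec K K2 /\ ~ near K K2.
    apply: far => // [|k]; first by apply: ae2 r2 (sup 2) => n ->; lia.
    by apply: ae2 r2 (sup (k + k).+2) => n ->; lia.
  by exists K2.
- move=> K mK; have [QK inf sup] := mK.
  have [|k|k|K2 m2 r2] := mid_of_rank (f := fun n => (rk K n)./2).
  + by apply: cpf_half; apply: rk_cpf.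
  + by apply: ae1 (inf (k + k).+2) => n; lia.
  + by apply: ae1 (sup k) => n; lia.
  have [h1 h2] : prec K2 K /\ ~ near K2 K.
    apply: far => // [|k]; first by apply: ae2 r2 (inf 2) => n ->; lia.
    by apply: ae2 r2 (inf (k + k).+2) => n ->; lia.
  by exists K2.
- exact: part_near.
Qed.

Lemma part_big : part big_type Q.
Proof.
apply: part_ext (part_plus (part_plus part_low part_mid _) part_high _).
- by move=> K; rewrite -rank_cases.
- move=> K K' [QK [k rK]] [QK' inf _]; apply: rk_mono => //.
  by apply: ae2 rK (inf k) => n ->.
- move=> K K' [[QK [k rK]]|[QK _ sup]] [QK' [l rK']]; apply: rk_mono => //.
    by apply: ae3 rK rK' (sigma_infty (k + l.+1)) => n ->; lia.
  by apply: ae2 rK' (sup l.+1) => n; lia.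
Qed.

End Infinite.
End Ranks.

(** * The colored copy of omega *)

Definition bounded (S : nat -> Prop) := exists N, forall y, S y -> y <= N.

Lemma bounded_union m (S : nat -> nat -> Prop) : (forall i, i < m -> bounded (S i)) ->
  bounded (fun y => exists2 i, i < m & S i y).
Proof.
elim: m => [|m IH] bS; first by exists 0 => y [].
have [N HN] : bounded (fun y => exists2 i, i < m & S i y).
  by apply: IH => i lt; apply: bS; apply: ltnW.
have [M HM] := bS m (ltnSn m); exists (maxn N M) => y [i].
rewrite ltnS leq_eqVlt leq_max => /predU1P [-> /HM -> |lt Sy].
  by rewrite orbT.
by rewrite HN //; exists i.
Qed.

Lemma bounded_sub (S S' : nat -> Prop) : (forall y, S y -> S' y) -> bounded S' -> bounded S.
Proof. by move=> sub [N HN]; exists N => y /sub /HN. Qed.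

Lemma bounded_pair (A : nat -> Prop) (B : nat -> nat -> Prop) :
  bounded A -> (forall u, A u -> bounded (B u)) ->
  bounded (fun x => A (fst_nat x) /\ B (fst_nat x) (snd_nat x)).
Proof.
move=> [N HN] bB.
have [M HM] : bounded (fun v => exists2 u, u < N.+1 & A u /\ B u v).
  apply: bounded_union => u _; case: (pselect (A u)) => [/bB [M HM]|nA].
    by exists M => v [_ /HM].
  by exists 0 => v [].
have [K HK] : bounded (fun x => exists2 u, u < N.+1 & exists2 v, v < M.+1 & x = pair_nat u v).
  apply: bounded_union => u _; apply: bounded_union => v _.
  by exists (pair_nat u v) => _ ->.
exists K => x [Ax Bx]; apply: HK; exists (fst_nat x); first by rewrite ltnS HN.
exists (snd_nat x); last by rewrite pair_eta.
by rewrite ltnS HM //; exists (fst_nat x); rewrite ?ltnS ?HN.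
Qed.

(** A dyadic fraction [i / 2 ^ r] with [i] odd is in lowest terms. *)
Lemma odd_frac_inj i r i' r' : odd i -> odd i' -> i * 2 ^ r' = i' * 2 ^ r ->
  r = r' /\ i = i'.
Proof.
have aux a b c d : odd a -> odd c -> b <= d -> a * 2 ^ d = c * 2 ^ b -> b = d /\ a = c.
  move=> oa oc bd; rewrite -(subnK bd) expnD mulnA => /eqP.
  rewrite eqn_pmul2r ?expn_gt0 // => /eqP e.
  case E : (d - b) e => [|k] e; last first.
    by move: oc; rewrite -e expnS mulnCA oddM.
  by split; [lia|rewrite -e muln1].
move=> oi oi' e; case: (leqP r r') => [le|/ltnW le]; first exact: aux.
by have [-> ->] := aux i' r' i r oi' oi le (esym e).
Qed.

Section ColoredOmega.
(* Color [c] asks for blocks of size [kf c]; it is refuted when [P c z] fails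
   for some [z], and then its blocks at level [j] get [j.+1] more elements.
   [H c j s] says that color [c] is available at stage [s] of level [j]. *)
Variables (kf : nat -> nat) (P : nat -> nat -> bool) (H : nat -> nat -> nat -> bool).
Hypotheses (tc_kf : tc kf) (tcP : tc2 (fun c z => P c z))
  (tcH : tc3 (fun c j s => H c j s)).
Hypothesis H_limit : forall c j, exists b, eventually (fun s => H c j s = b).

Definition level x := fst_nat x.
Definition stage x := fst_nat (snd_nat x).
Definition color x := fst_nat (snd_nat (snd_nat x)).
Definition place x := fst_nat (snd_nat (snd_nat (snd_nat x))).
Definition index x := snd_nat (snd_nat (snd_nat (snd_nat x))).
Definition elt j s c i m := pair_nat j (pair_nat s (pair_nat c (pair_nat i m))).
Definition block x := elt (level x) (stage x) (color x) (place x) 0.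
(** Each stage consists of one round per color. As colors are at most the level, the round
    determines stage and color. *)
Definition round x := stage x * (level x).+1 + color x.

Definition least_refuter c z := ~~ P c z && ball z (fun z' => P c z').

(** An additional index is at least as large as the refuter behind it, so the search may stop at [m]
    and membership is decidable. *)
Definition valid c j m := (m < kf c) ||
  bex m.+1 (fun z => [&& least_refuter c z, kf c + z <= m & m <= kf c + z + j]).

(** Odd places below [2 ^ (round x).+1] give the dyadic points of (0, 2) that are new in this round:
    round 0 offers the point 1 alone, and each later round bisects every gap of the grid. *)
Definition in_dom x := [&& active H (level x) (stage x),
  H (color x) (level x) (stage x), color x <= level x, odd (place x),
  place x < 2 ^ (round x).+1 & valid (color x) (level x) (index x)].

(* Within a level the elements sit at the dyadic positions
   [place x / 2 ^ round x]. *)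
Definition left_of x y := place x * 2 ^ round y < place y * 2 ^ round x.

Definition elt_lt x y := [&& in_dom x, in_dom y & (level x < level y) ||
  (level x == level y) &&
    (left_of x y || (block x == block y) && (index x < index y))].

Lemma tc_in_dom : tc (fun x => in_dom x).
Proof.
have Ha := tc_active tcH.
rewrite /in_dom /valid /least_refuter /round /level /stage /color /place /index.
by tc_auto.
Qed.

Lemma tc_elt_lt : tc2 (fun x y => elt_lt x y).
Proof.
have Hd := tc_in_dom.
rewrite /elt_lt /left_of /block /elt /round /level /stage /color /place /index.
by tc_auto.
Qed.

Lemma eltE j s c i m (x := elt j s c i m) :
  [/\ level x = j, stage x = s, color x = c, place x = i & index x = m].
Proof.
by rewrite /x /elt /level /stage /color /place /index; split; rewrite !pairE.
Qed.

Lemma elt_eta x : elt (level x) (stage x) (color x) (place x) (index x) = x.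
Proof. by rewrite /elt /level /stage /color /place /index !pair_eta. Qed.

Lemma blockP x y : block x = block y <->
  [/\ level x = level y, stage x = stage y, color x = color y & place x = place y].
Proof.
split=> [|[e1 e2 e3 e4]]; last by rewrite /block e1 e2 e3 e4.
move=> /pair_inj [e1 /pair_inj [e2 /pair_inj [e3 /pair_inj [e4 _]]]].
by split.
Qed.

Lemma block_inj x y : block x = block y -> index x = index y -> x = y.
Proof.
by move=> /blockP [e1 e2 e3 e4] e5; rewrite -(elt_eta x) e1 e2 e3 e4 e5 elt_eta.
Qed.

Lemma block_round x y : block x = block y -> round x = round y /\ place x = place y.
Proof. by move=> /blockP [e1 e2 e3 e4]; rewrite /round e1 e2 e3. Qed.

Lemma left_of_irr x : left_of x x = false.
Proof. by rewrite /left_of ltnn. Qed.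

Lemma left_of_trans x y z : left_of x y -> left_of y z -> left_of x z.
Proof.
rewrite /left_of => h1 h2.
have p r : 0 < 2 ^ r by rewrite expn_gt0.
move: (p (round x)) (p (round y)) (p (round z)) h1 h2.
move: (2 ^ round x) (2 ^ round y) (2 ^ round z) (place x) (place y) (place z).
move=> a b c i j k a0 b0 c0 h1 h2; rewrite -(ltn_pmul2r b0).
apply: (@ltn_trans (j * a * c)); first by rewrite mulnAC ltn_pmul2r.
by rewrite mulnAC [X in _ < X]mulnAC ltn_pmul2r.
Qed.

Lemma left_of_block x x' y y' : block x = block x' -> block y = block y' ->
  left_of x y = left_of x' y'.
Proof. by rewrite /left_of => /block_round [-> ->] /block_round [-> ->]. Qed.

Lemma elt_lt_irr x : ~ elt_lt x x.
Proof. by case/and3P => _ _; rewrite !ltnn left_of_irr !andbF. Qed.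

Lemma elt_lt_dom x y : elt_lt x y -> in_dom x /\ in_dom y.
Proof. by case/and3P. Qed.

Lemma elt_lt_trans x y z : elt_lt x y -> elt_lt y z -> elt_lt x z.
Proof.
case/and3P => dx dy xy /and3P [_ dz yz]; rewrite /elt_lt dx dz /=.
case/orP: xy yz => [xy|/andP[/eqP exy xy]].
  case/orP=> [yz|/andP[/eqP <- _]]; last by rewrite xy.
  by rewrite (ltn_trans xy yz).
rewrite exy; case/orP=> [->//|/andP[-> yz]]; apply/orP; right => /=.
case/orP: xy yz => [xy|/andP[/eqP bxy ixy]].
  case/orP=> [yz|/andP[/eqP byz _]]; first by rewrite (left_of_trans xy yz).
  by rewrite -(left_of_block (erefl (block x)) byz) xy.
rewrite (left_of_block bxy (erefl (block z))) bxy.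
case/orP=> [->//|/andP[-> iyz]] /=.
by rewrite (ltn_trans ixy iyz) orbT.
Qed.

Lemma in_domP x : in_dom x -> [/\ color x <= level x, odd (place x),
  place x < 2 ^ (round x).+1 & valid (color x) (level x) (index x)].
Proof. by case/and5P => _ _ ? ? /andP[]. Qed.

Lemma elt_lt_total x y : in_dom x -> in_dom y -> [\/ elt_lt x y, x = y | elt_lt y x].
Proof.
move=> dx dy; rewrite /elt_lt dx dy /=.
case: (ltngtP (level x) (level y)) => [_|_|ej] /=;
  [by constructor 1|by constructor 3|].
rewrite /left_of; case: ltngtP => [_|_|e] /=; [by constructor 1|by constructor 3|].
have [cx ox _ _] := in_domP dx; have [cy oy _ _] := in_domP dy.
have [er ei] := odd_frac_inj ox oy e.
(* Euclidean division by the number of colors of the level recovers stage and color from the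
   round. *)
have [es ec] : stage x = stage y /\ color x = color y.
  move: er cx cy; rewrite /round ej -ltnS -[color y <= _]ltnS => er cx cy.
  have := congr1 (fun n => n %/ (level y).+1) er.
  rewrite !divnMDl // !divn_small // !addn0 => es; split=> //.
  by move: er; rewrite es => /addnI.
have eb : block x = block y by apply/blockP.
rewrite eb eqxx /=; case: ltngtP => [_|_|em];
  [by constructor 1|by constructor 3|constructor 2].
exact: block_inj.
Qed.

Lemma valid_bounded c j : bounded (valid c j).
Proof.
case: (pselect (exists z, least_refuter c z)) => [[z /andP[nz /ballP mz]]|nz].
  exists (kf c + z + j) => m /orP[lt|/bexP [z' _ /and3P[/andP[nz' /ballP mz'] _ le]]].
    by apply: leq_trans (ltnW lt) _; rewrite -addnA leq_addr.
  suff <- : z' = z by [].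
  case: (ltngtP z z') => // [/mz'|/mz] h; by [rewrite h in nz|rewrite h in nz'].
exists (kf c) => m /orP[/ltnW //|/bexP [z _ /and3P[h _ _]]].
by case: nz; exists z.
Qed.

(** A level has finitely many active stages, and each of them adds finitely many blocks, all finite.
    The nested claims follow the nesting of pairs in [elt]. *)
Lemma level_bounded N : bounded (fun x => in_dom x /\ level x <= N).
Proof.
have [M HM] := choice (active_bounded H_limit).
pose S := fun x => level x <= N /\ (stage x <= M (level x) /\ (color x <= level x /\
  (place x < 2 ^ (round x).+1 /\ valid (color x) (level x) (index x)))).
apply: (@bounded_sub _ S).
  by move=> x [/and5P[h1 _ h3 _ /andP[h5 h6]] h]; split=> //; split=> //; apply: HM.
apply: (bounded_pair (A := fun j => j <= N) (B := fun j x => (fst_nat x <= M j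
  /\ (fst_nat (snd_nat x) <= j /\
  (fst_nat (snd_nat (snd_nat x)) < 2 ^ (fst_nat x * j.+1 + fst_nat (snd_nat x)).+1 /\
   valid (fst_nat (snd_nat x)) j (snd_nat (snd_nat (snd_nat x)))))))).
  by exists N.
move=> j _.
apply: (bounded_pair (A := fun s => s <= M j) (B := fun s x => (fst_nat x <= j /\
  (fst_nat (snd_nat x) < 2 ^ (s * j.+1 + fst_nat x).+1 /\
   valid (fst_nat x) j (snd_nat (snd_nat x)))))).
  by exists (M j).
move=> s _.
apply: (bounded_pair (A := fun c => c <= j) (B := fun c x =>
  (fst_nat x < 2 ^ (s * j.+1 + c).+1 /\ valid c j (snd_nat x)))).
  by exists j.
move=> c _.
apply: (bounded_pair (A := fun i => i < 2 ^ (s * j.+1 + c).+1)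
  (B := fun i x => valid c j x)).
  by exists (2 ^ (s * j.+1 + c).+1) => y /ltnW.
by move=> i _; apply: valid_bounded.
Qed.

Lemma elt_lt_bounded x : exists N, forall y, elt_lt y x -> y <= N.
Proof.
have [N HN] := level_bounded (level x); exists N => y /and3P[dy _ h]; apply: HN.
by split=> //; case/orP: h => [/ltnW //|/andP[/eqP -> _]].
Qed.

Definition last_stage j s := active H j s /\ forall t, s < t -> ~~ active H j t.

Lemma last_stage_exists j : exists s, last_stage j s.
Proof.
have [N HN] := active_bounded H_limit j.
have ex : exists s, active H j s by exists 0.
exists (ex_maxn ex HN); case: ex_maxnP => s as_ smax; split=> // t lt.
by apply/negP => /smax; rewrite leqNgt lt.
Qed.

Lemma last_stage_H j s c : last_stage j s -> c <= j ->
  eventually (fun t => H c j t) -> H c j s.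
Proof.
move=> [_ na] cj /eventually_ae [N HN].
have [_ /(_ c cj) <-] := inactive_stable na (leq_maxl s N).
by apply: HN; rewrite leq_maxr.
Qed.

(** The second clause excludes a never refuted color of size 0, whose blocks would be empty. *)
Definition solid c := (forall j, eventually (fun s => H c j s)) /\
  (forall j, exists m, valid c j m).

Lemma solid_in_level c j : solid c -> c <= j ->
  exists z, [/\ in_dom z, level z = j & color z = c].
Proof.
move=> [Hc /(_ j) [m vm]] cj; have [s ls] := last_stage_exists j.
exists (elt j s c 1 m); rewrite /in_dom /round.
have [-> -> -> -> ->] := eltE j s c 1 m; split=> //.
by rewrite ls.1 (last_stage_H ls) // cj vm /= (ltn_exp2l 0).
Qed.

(** The element is put at the last stage, at distance [1 / 2 ^ r] to the right of [x]. Elements of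
    earlier stages sit at multiples of [2 / 2 ^ r], so those right of [x] are right of the new one
    too. *)
Lemma solid_right c x t : solid c -> in_dom x -> c <= level x ->
  stage x < t -> active H (level x) t ->
  exists z, [/\ in_dom z, level z = level x, color z = c, left_of x z &
    forall y t', in_dom y -> level y = level x -> stage y < t' ->
      active H (level x) t' -> left_of x y -> left_of z y].
Proof.
move=> [Hc /(_ (level x)) [m vm]] dx cj xt at_; set j := level x in cj at_ vm *.
have [s ls] := last_stage_exists j.
(* All rounds of a stage before the last one precede all rounds of the last one, whatever the
   colors. *)
have later y t' : in_dom y -> level y = j -> stage y < t' -> active H j t' ->
    round y < s * j.+1 + c.
  move=> /in_domP[cy _ _ _] ey yt' at'.
  have ts : t' <= s by rewrite leqNgt; apply: contraL at' => /ls.2.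
  rewrite /round ey in cy *.
  apply: (@leq_trans (stage y * j.+1 + j.+1)); first by rewrite ltn_add2l ltnS.
  by rewrite -mulSnr (leq_trans _ (leq_addr _ _)) // leq_mul2r (leq_trans yt').
set r := s * j.+1 + c in later.
have lx := later x t dx erefl xt at_.
have [_ ox ux _] := in_domP dx.
have even_pow y : round y < r -> 2 ^ r = 2 ^ (r - round y) * 2 ^ round y.
  by move=> /ltnW le; rewrite -expnD subnK.
set d := 2 ^ (r - round x).
have ev y : round y < r -> ~~ odd (2 ^ (r - round y)).
  by move=> lt; rewrite oddX negb_or subn_eq0 -ltnNge lt.
pose z := elt j s c (place x * d).+1 m; have [ej es ec ei em] := eltE j s c (place x * d).+1 m.
have er : round z = r by rewrite /round ej es ec.
have zi : place z < 2 ^ (round z).+1.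
  rewrite er ei expnS (even_pow x lx) -/d.
  have : (place x).+1 * d <= 2 ^ (round x).+1 * d by rewrite leq_mul2r ux orbT.
  have d2 : 1 < d by rewrite /d -{1}(expn0 2) ltn_exp2l // subn_gt0.
  rewrite expnS mulSn; lia.
exists z; split=> //.
- rewrite /in_dom zi ej es ec ei em vm ls.1 (last_stage_H ls) // cj /= oddM.
  by rewrite (negbTE (ev x lx)) andbF.
- by rewrite /left_of er ei (even_pow x lx) -/d mulnA ltn_pmul2r ?expn_gt0.
- move=> y t' dy ey yt' at'; have ly := later y t' dy ey yt' at'.
  rewrite /left_of er ei => xy.
  have : place x * d < place y * 2 ^ (r - round y).
    rewrite -(@ltn_pmul2r (2 ^ round x * 2 ^ round y)) ?muln_gt0 ?expn_gt0 //.
    have -> : place x * d * (2 ^ round x * 2 ^ round y) = place x * 2 ^ round y * 2 ^ r.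
      by rewrite (even_pow x lx) -/d; lia.
    have -> : place y * 2 ^ (r - round y) * (2 ^ round x * 2 ^ round y)
        = place y * 2 ^ round x * 2 ^ r by rewrite (even_pow y ly); lia.
    by rewrite ltn_pmul2r ?expn_gt0.
  (* At scale [r] the place of the new element is odd and that of [y] is even, which rules out
     equality. *)
  rewrite (even_pow y ly) mulnA ltn_pmul2r ?expn_gt0 // leq_eqVlt => /predU1P [e|//].
  have := congr1 odd e; rewrite /= !oddM (negbTE (ev x lx)) (negbTE (ev y ly)).
  by rewrite !andbF.
Qed.

End ColoredOmega.

(** * Its cohesive powers *)

Section PowerOfColored.
Variables (kf : nat -> nat) (P : nat -> nat -> bool) (H : nat -> nat -> nat -> bool).
Hypotheses (tc_kf : tc kf) (tcP : tc2 (fun c z => P c z))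
  (tcH : tc3 (fun c j s => H c j s)).
Hypothesis H_limit : forall c j, exists b, eventually (fun s => H c j s = b).
Variable c0 : nat.
Hypothesis c0_solid : solid kf P H c0.

Local Notation dom := (in_dom kf P H).
Local Notation lt := (elt_lt kf P H).

Lemma colored_dom_computable : computable [set x | dom x].
Proof. by apply: bool_computable (tc_in_dom tc_kf tcP tcH) _. Qed.

Lemma colored_lt_computable : computable_rel (fun x y => lt x y).
Proof.
have tcl := tc_elt_lt tc_kf tcP tcH.
by apply: (@bool_computable (fun u => lt (fst_nat u) (snd_nat u))); first by tc_auto.
Qed.

Lemma colored_nonempty : [set x | dom x] !=set0.
Proof. by have [z [dz _ _]] := solid_in_level H_limit c0_solid (leqnn c0); exists z. Qed.

Definition colored_omega : computable_linear_order :=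
  @ComputableLinearOrder [set x | dom x] (fun x y => lt x y) colored_nonempty
    colored_dom_computable colored_lt_computable (fun x y => @elt_lt_dom kf P H x y)
    (@elt_lt_irr kf P H) (@elt_lt_trans kf P H) (@elt_lt_total kf P H).

Lemma colored_enumeration : exists g : nat -> nat, [/\ forall n, dom (g n),
  forall n m, n < m -> lt (g n) (g m) & forall x, dom x -> exists n, g n = x].
Proof.
apply: (@omega_enumeration (fun x => dom x) (fun x y => lt x y)).
- by move=> x y /elt_lt_dom [].
- exact: elt_lt_irr.
- exact: elt_lt_trans.
- exact: elt_lt_total.
- by move=> x _; apply: elt_lt_bounded.
- move=> N; have [z [dz lz _]] := solid_in_level H_limit c0_solid (leq_maxr N.+1 c0).
  exists z => //; apply: leq_trans (leq_maxl N.+1 c0) _.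
  by rewrite -lz -[X in _ <= X](pair_eta z) leq_pair.
Qed.

Lemma colored_omega_copy : computable_copy_of_omega colored_omega.
Proof.
have [g [gd gm gs]] := colored_enumeration.
have lin : linear (clo_order colored_omega).
  split=> [[x dx]|[x dx] [y dy] [z dz]|[x dx] [y dy]] /=.
  - exact: elt_lt_irr.
  - exact: elt_lt_trans.
  - case: (elt_lt_total dx dy) => h; [constructor 1|constructor 2|constructor 3] => //.
    exact: eq_exist.
apply: part_iso lin linear_omega _.
exists (fun n : nat => exist _ (g n) (gd n) : clo_order colored_omega).
split=> [n m nm|//|[x dx] _]; first exact: gm.
by have [n e] := gs x dx; exists n; apply: eq_exist.
Qed.

(** * Standard part and nonstandard blocks of a power *)

Section Power.
Variable C : set nat.
Hypotheses (C_coh : cohesive C) (C_sigma : Sigma 2 C).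
Let T := cohesive_power colored_omega C.
Local Notation rep := (@rep colored_omega C).

Let rep_dom' (K : T) : ae C (fun n => dom (rep K n)).
Proof. exact: (@rep_dom colored_omega C K). Qed.

Let rep_lt (K K' : T) : prec K K' <-> ae C (fun n => lt (rep K n) (rep K' n)).
Proof. exact: (@power_prec colored_omega C K). Qed.

Lemma cpf_coord h (K : T) : tc h -> cpf C (fun n => h (rep K n)).
Proof. by move=> th; apply: cpf_comp th (rep_cpf K). Qed.

Lemma tc_level : tc level. Proof. by rewrite /level; tc_auto. Qed.
Lemma tc_stage : tc stage. Proof. by rewrite /stage; tc_auto. Qed.
Lemma tc_color : tc color. Proof. by rewrite /color; tc_auto. Qed.
Lemma tc_place : tc place. Proof. by rewrite /place; tc_auto. Qed.
Lemma tc_index : tc index. Proof. by rewrite /index; tc_auto. Qed.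
Lemma tc_block : tc block.
Proof. by rewrite /block /elt /level /stage /color /place; tc_auto. Qed.

Definition standard (K : T) := exists k, ae C (fun n => rep K n = k).
Definition nonstandard (K : T) := forall k, ae C (fun n => k < level (rep K n)).
Definition same (K K' : T) := [/\ nonstandard K, nonstandard K'
  & ae C (fun n => block (rep K n) = block (rep K' n))].

(** If the level is almost constant, the representative almost always stays in one finite level, so
    it cannot tend to infinity. *)
Lemma standard_or_not K : standard K \/ nonstandard K.
Proof.
have [[j lj]|inf] := cpf_const_or_infty C_coh (cpf_coord K tc_level); last by right.
have [//|inf] := cpf_const_or_infty C_coh (rep_cpf K); first by left.
have [N HN] := level_bounded kf P H_limit j.
case: (ae_False C_coh); apply: ae3 lj (inf N) (rep_dom' K) => n ej lt dx.
by move: lt; rewrite ltnNge HN // ej.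
Qed.

Lemma standard_prec K K' : standard K -> nonstandard K' -> prec K K'.
Proof.
move=> [k rk] inf; apply/rep_lt; apply: ae4 rk (inf (level k)) (rep_dom' K) (rep_dom' K').
by move=> n -> lt d d'; rewrite /elt_lt d d' lt.
Qed.

Lemma nonstandard_mono K K' :
  ae C (fun n => level (rep K n) <= level (rep K' n)) -> nonstandard K -> nonstandard K'.
Proof. by move=> le inf k; apply: ae2 le (inf k) => n h1 h2; apply: leq_trans h1. Qed.

Lemma part_standard : part omega standard.
Proof.
have [g [gd gm gs]] := colored_enumeration.
have ex k : exists K : T, ae C (fun n => rep K n = g k).
  by apply: rep_surj; [exact/cpf_tc/tc_const|apply: ae_all => n; apply: gd].
exists (fun k : omega => sval (cid (ex k))); split=> [i j ij|i|K [k rk]].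
- case: (cid (ex i)) => K1 r1; case: (cid (ex j)) => K2 r2 /=.
  by apply/rep_lt; apply: ae2 r1 r2 => n -> ->; apply: gm.
- by case: (cid _) => K r; exists (g i).
- have [n _ [dn en]] := ae_exists C_coh (ae_and (rep_dom' K) rk).
  have [m em] := gs _ dn; exists m; case: (cid _) => K' r' /=.
  by apply: rep_inj; apply: ae2 rk r' => i -> ->; rewrite em en.
Qed.

Lemma nonstandard_later K : nonstandard K ->
  ae C (fun n => exists2 t, stage (rep K n) < t & active H (level (rep K n)) t).
Proof.
move=> inf; apply: (later_active tcH C_coh C_sigma (cpf_coord K tc_level)
  (cpf_coord K tc_stage) inf).
Qed.

Lemma same_or_not K K' : nonstandard K -> nonstandard K' -> same K K' \/
  ae C (fun n => block (rep K n) != block (rep K' n)).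
Proof.
move=> nK nK'; have HD : tc2 (fun x y => block x == block y).
  by have h := tc_block; tc_auto.
have [h|h] := cpf_decide2 C_coh HD (rep_cpf K) (rep_cpf K'); [left|by right].
by split=> //; apply: ae1 h => n /eqP.
Qed.

(** Almost everywhere neither representative sits at the last stage of its level, so [solid_right]
    puts an element of color [c] just after that of [K]. A search turns these elements into an
    element of the power. *)
Lemma power_between c K K' : solid kf P H c -> nonstandard K -> nonstandard K' ->
  prec K K' -> ~ same K K' ->
  exists K2, [/\ nonstandard K2, prec K K2 /\ ~ same K K2, prec K2 K' /\ ~ same K2 K'
    & ae C (fun n => color (rep K2 n) = c)].
Proof.
move=> sc nK nK' /rep_lt KK' nE.
have [//|nb] := same_or_not nK nK'.
have HD : tc2 (fun u z => [&& lt (fst_nat u) z, lt z (snd_nat u), color z == c,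
    block (fst_nat u) != block z & block z != block (snd_nat u)]).
  have h1 := tc_elt_lt tc_kf tcP tcH; have h2 := tc_block; have h3 := tc_color.
  by tc_auto.
have [|f cf Hf] := cpf_search (cpf_pair (rep_cpf K) (rep_cpf K')) HD.
  have lK := nonstandard_later nK; have lK' := nonstandard_later nK'.
  apply: ae4 (ae_and KK' nb) lK lK' (nK c) => n [].
  rewrite !pairE; move: (rep K n) (rep K' n) => x y xy nbxy [t xt at_] [t' yt' at'] cx.
  have [dx dy] := elt_lt_dom xy.
  have [z [dz lz cz xz zy]] := solid_right H_limit sc dx (ltnW cx) xt at_.
  exists z; rewrite cz eqxx /elt_lt dx dy dz lz /= ltnn eqxx xz /=.
  have nxz : block x != block z.
    by apply: contraTneq xz => e; rewrite (left_of_block (erefl (block x)) (esym e)) left_of_irr.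
  (* If [y] is in a higher level, any element in the level of [x] precedes it. In the same level [y]
     was present before the last stage, hence lies right of [z]. *)
  rewrite nxz /=; case/and3P: xy => _ _ /orP [ltl|/andP[/eqP el /orP [xy|/andP[h _]]]].
  - rewrite ltl /=; apply: contraTneq ltl => /blockP [e _ _ _].
    by rewrite -lz e ltnn.
  - rewrite -el in at'; have {}zy := zy y t' dy (esym el) yt' at' xy.
    rewrite el eqxx zy orbT /=.
    by apply: contraTneq zy => e; rewrite (left_of_block (erefl (block z)) (esym e)) left_of_irr.
  - by rewrite h in nbxy.
have {}Hf : ae C (fun n => [/\ lt (rep K n) (f n), lt (f n) (rep K' n), color (f n) = c,
    block (rep K n) != block (f n) & block (f n) != block (rep K' n)]).
  by apply: ae1 Hf => n; rewrite !pairE => /and5P[? ? /eqP ? ? ?].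
have [|K2 r2] := rep_surj (L := colored_omega) cf.
  by apply: ae1 Hf => n [/elt_lt_dom []].
have {}Hf := ae_and r2 Hf.
exists K2; split.
- apply: nonstandard_mono nK; apply: ae1 Hf => n [-> [/and3P[_ _]]].
  by case/orP=> [/ltnW //|/andP[/eqP ->]].
- split; first by apply/rep_lt; apply: ae1 Hf => n [-> []].
  case=> _ _ e; apply: (ae_False C_coh); apply: ae2 Hf e => n [-> [_ _ _ h _]].
  by apply/eqP.
- split; first by apply/rep_lt; apply: ae1 Hf => n [-> []].
  case=> _ _ e; apply: (ae_False C_coh); apply: ae2 Hf e => n [-> [_ _ _ _ h]].
  by apply/eqP.
- by apply: ae1 Hf => n [-> []].
Qed.

Lemma nonstandard_at f : cpf C f -> (forall k, ae C (fun n => k < f n)) ->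
  exists2 K, nonstandard K & ae C (fun n => level (rep K n) = f n).
Proof.
move=> cf inf.
have HD : tc2 (fun l z => dom z && (level z == l)).
  by have h1 := tc_in_dom tc_kf tcP tcH; have h2 := tc_level; tc_auto.
have [|g cg Hg] := cpf_search cf HD.
  apply: ae1 (inf c0) => n /ltnW le.
  have [z [dz lz _]] := solid_in_level H_limit c0_solid le.
  by exists z; rewrite dz lz eqxx.
have [|K rK] := rep_surj (L := colored_omega) cg.
  by apply: ae1 Hg => n /andP[].
have lK : ae C (fun n => level (rep K n) = f n).
  by apply: ae2 rK Hg => n -> /andP[_ /eqP].
by exists K => // k; apply: ae2 lK (inf k) => n ->.
Qed.

Lemma nonstandard_level_prec K K' : nonstandard K -> nonstandard K' ->
  ae C (fun n => level (rep K n) < level (rep K' n)) -> prec K K' /\ ~ same K K'.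
Proof.
move=> nK nK' ltl; split.
  apply/rep_lt; apply: ae3 ltl (rep_dom' K) (rep_dom' K') => n h d d'.
  by rewrite /elt_lt d d' h.
case=> _ _ e; apply: (ae_False C_coh); apply: ae2 ltl e => n h /blockP [e _ _ _].
by rewrite e ltnn in h.
Qed.

Lemma nonstandard_above K : nonstandard K ->
  exists K', [/\ nonstandard K', prec K K' & ~ same K K'].
Proof.
move=> nK; have cl := cpf_comp (tc_succ tc_id) (cpf_coord K tc_level).
have [|K' nK' lK'] := nonstandard_at cl.
  by move=> k; apply: ae1 (nK k) => n h; rewrite ltnW.
have [h1 h2] : prec K K' /\ ~ same K K'.
  by apply: nonstandard_level_prec => //; apply: ae1 lK' => n ->.
by exists K'.
Qed.

Lemma nonstandard_below K : nonstandard K ->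
  exists K', [/\ nonstandard K', prec K' K & ~ same K' K].
Proof.
move=> nK; have cl := cpf_comp (tc_pred tc_id) (cpf_coord K tc_level).
have [|K' nK' lK'] := nonstandard_at cl.
  by move=> k; apply: ae1 (nK k.+1) => n; lia.
have [h1 h2] : prec K' K /\ ~ same K' K.
  by apply: nonstandard_level_prec => //; apply: ae2 lK' (nK 0) => n ->; lia.
by exists K'.
Qed.

Lemma nonstandard_exists : exists K, nonstandard K.
Proof.
have [|K nK _] := nonstandard_at (cpf_tc C tc_id); last by exists K.
by move=> k; exists k.+1.
Qed.

Lemma same_convex K1 K2 K3 : nonstandard K2 -> same K1 K3 ->
  prec K1 K2 -> prec K2 K3 -> same K1 K2.
Proof.
move=> n2 [n1 n3 b13] /rep_lt l12 /rep_lt l23; split=> //.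
apply: ae3 b13 l12 l23 => n b13 /and3P[_ _ l12] /and3P[_ _ l23].
have [e13 _ _ _] := (blockP _ _).1 b13.
case/orP: l12 => [l12|/andP[/eqP e12 l12]].
  by case/orP: l23 => [l23|/andP[/eqP e23 _]]; lia.
case/orP: l23 => [|/andP[_ l23]]; first by rewrite -e12 e13 ltnn.
case/orP: l12 => [l12|/andP[/eqP //]].
case/orP: l23 => [l23|/andP[/eqP b23 _]]; last by rewrite b23.
have := left_of_trans l12 l23.
by rewrite -(left_of_block (erefl (block (rep K1 n))) b13) left_of_irr.
Qed.

(* The extra elements of a refuted block have indices shifted by [z0]. *)
Lemma block_shape K : nonstandard K -> exists sigma z0, [/\ cpf C sigma, cpf C z0,
  ae C (fun n => kf (color (rep K n)) <= sigma n),
  ae C (fun n => forall m, valid kf P (color (rep K n)) (level (rep K n)) m =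
    (m < kf (color (rep K n))) || (kf (color (rep K n)) + z0 n <= m < sigma n + z0 n))
  & ae C (fun n => sigma n = kf (color (rep K n)) + (level (rep K n)).+1 /\
       exists z, ~~ P (color (rep K n)) z) \/
    ae C (fun n => sigma n = kf (color (rep K n)) /\ forall z, P (color (rep K n)) z)].
Proof.
move=> nK; have ck : cpf C (fun n => kf (color (rep K n))).
  by apply: (cpf_comp tc_kf); apply: cpf_coord tc_color.
have HD : tc2 (fun c z => ~~ P c z) by tc_auto.
have [ref|unref] := cpf_decide C_coh (cpf_coord K tc_color) HD; last first.
  exists (fun n => kf (color (rep K n))), (fun _ => 0); split=> //.
  - exact/cpf_tc/tc_const.
  - exact: ae_all.
  - apply: ae1 unref => n Pn m; rewrite !addn0 /valid; congr (_ || _).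
    apply/bexP/idP => [[z _ /and3P[/andP[h]]]|]; last by lia.
    by move: (Pn z); rewrite h.
  - by right; apply: ae1 unref => n Pn; split=> // z; have := Pn z; rewrite negbK.
have HD' : tc2 (fun c z => least_refuter P c z) by rewrite /least_refuter; tc_auto.
have [|z0 cz Hz] := cpf_search (cpf_coord K tc_color) HD'.
  apply: ae1 ref => n ex; case: (ex_minnP ex) => z nz min; exists z.
  rewrite /least_refuter nz; apply/ballP => i lt; apply: contraLR lt => /min.
  by rewrite -leqNgt.
exists (fun n => kf (color (rep K n)) + (level (rep K n)).+1), z0; split=> //.
- apply: cpf2 tc2_add ck _; apply: (cpf_comp (tc_succ tc_id)).
  exact: cpf_coord tc_level.
- by apply: ae_all => n; rewrite leq_addr.
- apply: ae1 Hz => n /andP[nz /ballP mz] m; rewrite /valid; congr (_ || _).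
  apply/bexP/idP => [[z lt /and3P[/andP[nz' /ballP mz'] h1 h2]]|h].
    have <- : z = z0 n; last by lia.
    case: (ltngtP z (z0 n)) => // [/mz|/mz'] h; by [rewrite h in nz'|rewrite h in nz].
  exists (z0 n); first by lia.
  rewrite /least_refuter nz; apply/and3P; split; [exact/ballP|lia|lia].
- by left; apply: ae1 ref => n.
Qed.

(** Closes the gap of length [z0] between the original elements of the block and the additional
    ones. *)
Definition rank K0 z0 (K : T) n : nat :=
  if index (rep K n) < kf (color (rep K0 n)) then index (rep K n)
  else index (rep K n) - z0 n.

(** Through [rank], the class of [K] is a cohesive power of orders of size [sigma n]. The facts [h1]
    to [h5] are the hypotheses on ranks under which such powers were analyzed. *)
Lemma part_block K : nonstandard K -> exists sigma, [/\ cpf C sigma,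
  (forall k, ae C (fun n => sigma n = k) -> part (fin_order k) (same K)),
  ((forall k, ae C (fun n => k < sigma n)) -> part big_type (same K)),
  ae C (fun n => 0 < sigma n)
  & ae C (fun n => sigma n = kf (color (rep K n)) + (level (rep K n)).+1 /\
       exists z, ~~ P (color (rep K n)) z) \/
    ae C (fun n => sigma n = kf (color (rep K n)) /\ forall z, P (color (rep K n)) z)].
Proof.
move=> nK; have [sigma [z0 [cs cz le val cases]]] := block_shape nK.
exists sigma.
have ck : cpf C (fun n => kf (color (rep K n))).
  by apply: (cpf_comp tc_kf); apply: cpf_coord tc_color.
have idx K' : same K K' -> ae C (fun n => [/\ block (rep K n) = block (rep K' n),
    dom (rep K' n) & (index (rep K' n) < kf (color (rep K n))) ||
     (kf (color (rep K n)) + z0 n <= index (rep K' n) < sigma n + z0 n)]).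
  case=> _ nK' bK'; apply: ae3 bK' val (rep_dom' K') => n b <- d; split=> //.
  by have [_ _ _] := in_domP d; have [-> _ -> _] := (blockP _ _).1 b.
have h1 K' : same K K' -> cpf C (rank K z0 K').
  move=> _; have ti : tc3 (fun m k z => if m < k then m else m - z) by tc_auto.
  have := cpf_comp ti (cpf_pair (cpf_coord K' tc_index) (cpf_pair ck cz)).
  by under eq_fun do rewrite !pairE.
have h2 K' : same K K' -> ae C (fun n => rank K z0 K' n < sigma n).
  move=> /idx h; apply: ae2 h le => n [_ _]; rewrite /rank; case: ifP; lia.
have h3 K1 K2 : same K K1 -> same K K2 ->
    ae C (fun n => rank K z0 K1 n < rank K z0 K2 n) -> prec K1 K2.
  move=> /idx i1 /idx i2 h; apply/rep_lt.
  apply: ae3 i1 i2 h => n [b1 d1 v1] [b2 d2 v2] h.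
  rewrite /elt_lt d1 d2 -b1 -b2 eqxx; have [<- _ _ _] := (blockP _ _).1 b1.
  have [<- _ _ _] := (blockP _ _).1 b2; rewrite eqxx /= [_ || _]orbC /=.
  have -> : index (rep K1 n) < index (rep K2 n); last by rewrite /= ?orbT.
  by move: h v1 v2; rewrite /rank; case: ifP; case: ifP; lia.
have h4 K1 K2 : same K K1 -> same K K2 ->
    ae C (fun n => rank K z0 K1 n = rank K z0 K2 n) -> K1 = K2.
  move=> /idx i1 /idx i2 h; apply: rep_inj.
  apply: ae3 i1 i2 h => n [b1 d1 v1] [b2 d2 v2] h.
  apply: block_inj; first by rewrite -b1.
  by move: h v1 v2; rewrite /rank; case: ifP; case: ifP; lia.
have h5 f : cpf C f -> ae C (fun n => f n < sigma n) ->
    exists2 K', same K K' & ae C (fun n => rank K z0 K' n = f n).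
  move=> cf lt.
  pose m n := if f n < kf (color (rep K n)) then f n else f n + z0 n.
  have cm : cpf C m.
    have ti : tc3 (fun m k z => if m < k then m else m + z) by tc_auto.
    have := cpf_comp ti (cpf_pair cf (cpf_pair ck cz)).
    by under eq_fun do rewrite !pairE.
  (* An element of prescribed rank arises from [K] by changing the index alone. *)
  pose g n := elt (level (rep K n)) (stage (rep K n)) (color (rep K n))
    (place (rep K n)) (m n).
  have cg : cpf C g.
    by do !apply: cpf_pair => //; apply: cpf_coord; [exact: tc_level|exact: tc_stage|
      exact: tc_color|exact: tc_place].
  have [|K' r] := rep_surj (L := colored_omega) cg.
    apply: ae3 val (rep_dom' K) lt => n val /and5P[d1 d2 d3 d4 /andP[d5 _]] lt /=.
    rewrite /in_dom /round /g.
    have [-> -> -> -> ->] := eltE (level (rep K n)) (stage (rep K n)) (color (rep K n))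
      (place (rep K n)) (m n).
    rewrite d1 d2 d3 d4 -/(round _) d5 val /= /m.
    by case: ifP; lia.
  have b : ae C (fun n => block (rep K n) = block (rep K' n)).
    apply: ae1 r => n ->; apply/blockP.
    by have [-> -> -> -> _] := eltE (level (rep K n)) (stage (rep K n)) (color (rep K n))
      (place (rep K n)) (m n).
  exists K'.
    split=> //; apply: nonstandard_mono nK; apply: ae1 b => n /blockP [-> _ _ _].
    exact: leqnn.
  apply: ae2 r le => n er lek; rewrite /rank er.
  have [_ _ _ _ ->] := eltE (level (rep K n)) (stage (rep K n)) (color (rep K n))
      (place (rep K n)) (m n).
  by rewrite /m; case: (ltnP (f n)) => h; [rewrite h|case: ifP; lia].
have sK : same K K by split=> //; apply: ae_all.
have [e Te] := power_countable colored_omega C.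
have lin := linear_power colored_omega C_coh.
split=> //.
- by move=> k; apply: (part_fin C_coh h1 h2 h3 h4 h5).
- exact: (part_big C_coh lin Te cs h1 h2 h3 h4 h5).
- by apply: ae1 (h2 K sK) => n; apply: leq_ltn_trans.
Qed.

(** * The shuffle of the block types *)

Section Types.
(** [big] tells whether the infinite block type takes part in the shuffle, so that both halves of
    the theorem share one argument. *)
Variables (X : set nat) (big : Prop) (Y : order_str -> Prop).
Hypothesis X_pos : ~ X 0.
Hypothesis X_color : forall k, X k -> exists c,
  [/\ kf c = k, forall z, P c z & forall j, eventually (fun s => H c j s)].
Hypothesis notX_bounded : forall k, 0 < k -> ~ X k -> exists N, forall c j s,
  kf c = k -> (forall z, P c z) -> H c j s -> c <= j -> j <= N.
Hypothesis big_color : big -> exists c,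
  (exists z, ~~ P c z) /\ forall j, eventually (fun s => H c j s).
Hypothesis notbig_bounded : ~ big ->
  (exists B, forall c, kf c <= B) /\ forall c z, P c z.
Hypothesis YE : forall Z, Y Z <-> finite_types X Z \/ (big /\ Z = big_type).

Definition block_size K n : nat :=
  if `[< exists z, ~~ P (color (rep K n)) z >]
  then kf (color (rep K n)) + (level (rep K n)).+1 else kf (color (rep K n)).

Lemma same_block_size K K' : same K K' ->
  ae C (fun n => block_size K n = block_size K' n).
Proof.
case=> _ _; apply: ae1 => n /blockP [e1 _ e2 _].
by rewrite /block_size e1 e2.
Qed.

(** Types are compared by equality of structures, so that the size determines the type outright and
    not only up to isomorphism. *)
Definition block_type K Z :=
  (exists k, [/\ X k, Z = fin_order k & ae C (fun n => block_size K n = k)]) \/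
  [/\ big, Z = big_type & forall k, ae C (fun n => k < block_size K n)].

Lemma block_type_fun K Z Z' : block_type K Z -> block_type K Z' -> Z = Z'.
Proof.
have neq k : ae C (fun n => block_size K n = k) ->
    (forall k, ae C (fun n => k < block_size K n)) -> False.
  move=> h inf; apply: (ae_False C_coh); apply: ae2 h (inf k) => n ->.
  by rewrite ltnn.
case=> [[k [_ -> h]]|[_ -> inf]] [[k' [_ -> h']]|[_ -> inf']] //.
- by have [n _ [<- <-]] := ae_exists C_coh (ae_and h h').
- by case: (neq k).
- by case: (neq k').
Qed.

Lemma block_type_same K K' Z : same K K' -> block_type K Z -> block_type K' Z.
Proof.
move=> /same_block_size e [[k [Xk eZ h]]|[b eZ inf]]; [left|right].
  by exists k; split=> //; apply: ae2 e h => n ->.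
by split=> // k; apply: ae2 e (inf k) => n ->.
Qed.

(** The size is almost constant or tends to infinity. A constant size [k] outside [X] is impossible:
    a refuted block grows with its level, and unrefuted ones of size [k] occur only up to some level
    [N]. *)
Lemma block_type_exists K : nonstandard K ->
  exists2 Z, block_type K Z & part Z (same K).
Proof.
move=> nK; have [sigma [cs pfin pbig pos cases]] := part_block nK.
have bs : ae C (fun n => block_size K n = sigma n).
  case: cases; apply: ae1 => n [-> h]; rewrite /block_size.
    by rewrite asboolT.
  by rewrite asboolF // => -[z]; rewrite h.
have [[k sk]|inf] := cpf_const_or_infty C_coh cs; last first.
  exists big_type; last exact: pbig.
  right; split=> // [|k]; last by apply: ae2 bs (inf k) => n ->.
  apply: contrapT => /notbig_bounded [[B HB] HP].
  case: (ae_False C_coh); case: cases => h.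
    by apply: ae1 h => n [_ [z]]; rewrite HP.
  by apply: ae2 h (inf B) => n [-> _]; rewrite ltnNge HB.
exists (fin_order k); last exact: pfin.
left; exists k; split=> //; last by apply: ae2 bs sk => n -> ->.
apply: contrapT => nX.
have [n _ [n0 nk]] := ae_exists C_coh (ae_and pos sk); rewrite nk in n0.
have [N HN] := notX_bounded n0 nX.
case: (ae_False C_coh); case: cases => h.
  by apply: ae3 h sk (nK k) => m [-> _] <-; lia.
apply: ae4 h sk (nK N) (rep_dom' K) => m [-> HP] ek Nl /and5P [_ Hm cl _ _].
by move: Nl; rewrite ltnNge (HN _ _ _ ek HP Hm cl).
Qed.

Lemma color_of_type Z : Y Z -> exists2 c, solid kf P H c &
  forall K, nonstandard K -> ae C (fun n => color (rep K n) = c) -> block_type K Z.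
Proof.
case/YE => [[k Xk ->]|[b ->]].
  have [c [kc Pc Hc]] := X_color Xk; exists c.
    split=> // j; exists 0; rewrite /valid kc; case: (k) Xk => // /X_pos [].
  move=> K nK cK; left; exists k; split=> //; apply: ae1 cK => n e.
  by rewrite /block_size e asboolF // => -[z]; rewrite Pc.
have [c [Pc Hc]] := big_color b; exists c.
  split=> // j; case: (ex_minnP Pc) => z nz min; exists (kf c + z).
  apply/orP; right; apply/bexP; exists z; first by rewrite ltnS leq_addl.
  rewrite leqnn leq_addr /least_refuter nz !andbT; apply/ballP => i.
  by move=> lt; apply: contraLR lt => /min; rewrite -leqNgt.
move=> K nK cK; right; split=> // k; apply: ae2 cK (nK k) => n e lt.
by rewrite /block_size e asboolT //; lia.
Qed.

Lemma linear_block_type K Z : block_type K Z -> linear Z.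
Proof.
by case=> [[k [_ -> _]]|[_ -> _]]; [exact: linear_fin|exact: linear_big_type].
Qed.

Lemma power_has_type : has_type_omega_plus_shuffle Y T.
Proof.
have [e Te] := power_countable colored_omega C.
have lin := linear_power colored_omega C_coh.
pose typ K : order_str := if pselect (nonstandard K) is left h
  then s2val (cid2 (block_type_exists h)) else omega.
have typP K : nonstandard K -> block_type K (typ K) /\ part (typ K) (same K).
  by rewrite /typ; case: pselect => // h _; case: (cid2 _).
have [||||||||||r [rn rpart rlt rcov]] := @part_dense_sum T nonstandard same typ e lin.
- by move=> K nK; split=> //; apply: ae_all.
- by move=> K K' [nK nK' h]; split=> //; split=> //; apply: ae1 h => n ->.
- move=> K1 K2 K3 [n1 _ h] [_ n3 h']; split=> //.
  by apply: ae2 h h' => n -> ->.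
- by move=> K1 K2 K3; apply: same_convex.
- by move=> K _; apply: Te.
- exact: nonstandard_exists.
- move=> K K' nK nK' lt nE.
  by have [K2 [h1 h2 h3 _]] := power_between c0_solid nK nK' lt nE; exists K2.
- exact: nonstandard_above.
- exact: nonstandard_below.
- by move=> K /typP [].
exists (order_sum (fun q : eta => typ (r q))); last first.
  apply: part_iso lin _ _.
    apply: linear_plus; first exact: linear_omega.
    apply: linear_order_sum => [|q]; first exact: linear_eta.
    by have [/linear_block_type] := typP _ (rn q).
  apply: part_ext (part_plus part_standard rpart standard_prec) => K.
  by split=> // _; apply: standard_or_not.
exists (fun q => typ (r q)); split.
- move=> q; apply/YE; have [[[k [Xk -> _]]|[b -> _]] _] := typP _ (rn q).
    by left; exists k.
  by right.
- move=> Z YZ a b ab; have [ltab nE] := rlt a b ab.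
  (* A block of type [Z] is found between those of [a] and [b]. Some rational [q] represents it, and
     as the three classes differ, [q] lies strictly between. *)
  have [c sc cZ] := color_of_type YZ.
  have [K [nK [aK naK] [Kb nKb] cK]] := power_between sc (rn a) (rn b) ltab nE.
  have [q Kq] := rcov K nK; exists q; split; last first.
    have [tq _] := typP _ (rn q).
    rewrite (block_type_fun tq (block_type_same Kq (cZ K nK cK))).
    by exists id; [exists id|].
  have [irr tr _] := lin.
  have same_sym K1 K2 : same K1 K2 -> same K2 K1.
    by move=> [n1 n2 h]; split=> //; apply: ae1 h => n ->.
  have same_trans K1 K2 K3 : same K1 K2 -> same K2 K3 -> same K1 K3.
    move=> [n1 _ h] [_ n3 h']; split=> //.
    by apply: ae2 h h' => n -> ->.
  have qlt q1 q2 : prec (r q1) (r q2) -> (q1 <= q2)%R.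
    move=> h; rewrite Order.TotalTheory.leNgt; apply/negP => /rlt [h' _].
    by apply: (irr (r q1)); apply: tr h h'.
  apply/andP; split; rewrite Order.POrderTheory.lt_neqAle; apply/andP; split.
  + by apply: contra_not_neq naK => ->; apply: same_sym.
  + apply: qlt; case: lin => _ _ tot; case: (tot (r a) (r q)) => // [eq|h].
      by case: naK; rewrite eq; apply: same_sym.
    case: naK; apply: (same_trans _ (r q)); last exact: same_sym.
    by apply/same_sym/(same_convex (K3 := K)) => //; apply: same_sym.
  + by apply: contra_not_neq nKb => <-.
  + apply: qlt; case: lin => _ _ tot; case: (tot (r q) (r b)) => // [eq|h].
      by case: nKb; rewrite -eq.
    by case: nKb; apply: (same_convex (K3 := r q)).
- by exists id; [exists id|].
Qed.

End Types.
End Power.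
End PowerOfColored.

(** * Colorings from Boolean combinations of Sigma_2 sets *)

(** In the last clause [N] is uniform in the color: along [C] the color of a nonstandard block need
    not be almost constant, while its level tends to infinity. *)
Definition colorable (X : set nat) := exists kf P H, [/\ tc kf,
  tc2 (fun c z => P c z : bool), tc3 (fun c j s => H c j s : bool) &
  [/\ forall c j, exists b, eventually (fun s => H c j s = b),
   forall k, X k -> exists c,
     [/\ kf c = k, forall z, P c z & forall j, eventually (fun s => H c j s)]
  & forall k, ~ X k -> exists N, forall c j s,
     kf c = k -> (forall z, P c z) -> H c j s -> c <= j -> j <= N]].

(** Availability is monotone in the stage, hence has a limit. A true witness [y] for [k] in [B]
    blocks all levels from [y] on, for every [w] alike; if [k] is not in [A], every [w] is
    refuted. *)
Lemma colorable_diff A B : Sigma 2 A -> Sigma 2 B -> colorable (A `\` B).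
Proof.
move=> /sigma2P [R tcR AR] /sigma2P [S tcS BS].
pose H c j s := ball j.+1 (fun y => bex s (fun z => ~~ S (fst_nat c) y z)).
exists (fun c => fst_nat c), (fun c z => R (fst_nat c) (snd_nat c) z), H.
have Hmono c j s s' : s <= s' -> H c j s -> H c j s'.
  move=> le /ballP h; apply/ballP => y /h /bexP [z zs nS]; apply/bexP.
  by exists z => //; apply: leq_trans le.
split; [by tc_auto|by tc_auto|by rewrite /H; tc_auto|split].
- move=> c j; case: (pselect (exists s, H c j s)) => [[s Hs]|nH].
    by exists true; apply/eventually_ae; exists s => s' le; apply: Hmono Hs.
  by exists false; apply: ae_all => s; apply/negbTE/negP => h; apply: nH; exists s.
- move=> k [/AR [w Rw] nB]; exists (pair_nat k w); rewrite /H !pairE; split=> // j.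
  suff : eventually (fun s => forall y, y < j.+1 -> bex s (fun z => ~~ S k y z)).
    by apply: ae1 => s h; apply/ballP.
  apply: (@ae_ltn_bounded _ (fun y s => bex s (fun z => ~~ S k y z))) => y _.
  have [z nS] : exists z, ~~ S k y z.
    apply: contrapT => nz; apply/nB/BS; exists y => z.
    by apply: contrapT => /negP h; apply: nz; exists z.
  by apply/eventually_ae; exists z.+1 => s lt; apply/bexP; exists z.
- move=> k nX; case: (pselect (B k)) => [/BS [y Sy]|nB].
    exists y => c j s e _ /ballP h _; rewrite leqNgt; apply/negP => yj.
    have /bexP [z _] := h y (leq_trans yj (leqnSn j)).
    by rewrite e Sy.
  exists 0 => c j s e Rc _ _; case: nX; split=> //.
  by apply/AR; exists (snd_nat c) => z; rewrite -e.
Qed.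

(** A tag merges the two families of colors. Since [snd_nat c <= c], a color that is at most the
    level remains so when its tag is removed. *)
Lemma colorable_union X X' : colorable X -> colorable X' -> colorable (X `|` X').
Proof.
move=> [kf [P [H [t1 t2 t3 [lim col ncol]]]]] [kf' [P' [H' [t1' t2' t3' [lim' col' ncol']]]]].
exists (fun c => if fst_nat c == 0 then kf (snd_nat c) else kf' (snd_nat c)),
 (fun c z => if fst_nat c == 0 then P (snd_nat c) z else P' (snd_nat c) z),
 (fun c j s => if fst_nat c == 0 then H (snd_nat c) j s else H' (snd_nat c) j s).
split; [by tc_auto|by tc_auto|by tc_auto|split].
- by move=> c j; case: eqP => _.
- move=> k [/col|/col'] [c [e Pc Hc]]; [exists (pair_nat 0 c)|exists (pair_nat 1 c)];
    by rewrite !pairE.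
- move=> k nXX; have [|N HN] := ncol k; first by move=> h; apply: nXX; left.
  have [|N' HN'] := ncol' k; first by move=> h; apply: nXX; right.
  exists (maxn N N') => c j s; rewrite leq_max.
  have sc : snd_nat c <= c by rewrite -{2}(pair_eta c) leq_pair.
  case: eqP => _ e Pc Hc cj.
    by rewrite (HN _ _ _ e Pc Hc) // (leq_trans sc).
  by rewrite (HN' _ _ _ e Pc Hc) ?orbT // (leq_trans sc).
Qed.

(** A normal form for Boolean combinations of Sigma_2 sets; closure under intersection is what
    yields closure under complement. *)
Inductive diff_union : set nat -> Prop :=
| du_diff A B : Sigma 2 A -> Sigma 2 B -> diff_union (A `\` B)
| du_union X X' : diff_union X -> diff_union X' -> diff_union (X `|` X').

Lemma sigma2_inter A B : Sigma 2 A -> Sigma 2 B -> Sigma 2 (A `&` B).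
Proof.
move=> /sigma2P [R tcR AR] /sigma2P [S tcS BS]; apply/sigma2P.
exists (fun x y z => R x (fst_nat y) z && S x (snd_nat y) z); first by tc_auto.
move=> x; split=> [[/AR [y Ry] /BS [y' Sy]]|[y h]].
  by exists (pair_nat y y') => z; rewrite !pairE Ry Sy.
by split; [apply/AR; exists (fst_nat y)|apply/BS; exists (snd_nat y)] => z;
  have /andP [] := h z.
Qed.

Lemma sigma2_union A B : Sigma 2 A -> Sigma 2 B -> Sigma 2 (A `|` B).
Proof.
move=> /sigma2P [R tcR AR] /sigma2P [S tcS BS]; apply/sigma2P.
exists (fun x y z => if fst_nat y == 0 then R x (snd_nat y) z else S x (snd_nat y) z).
  by tc_auto.
move=> x; split=> [[/AR|/BS] [y Hy]|[y]].
- by exists (pair_nat 0 y) => z; rewrite !pairE; apply: Hy.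
- by exists (pair_nat 1 y) => z; rewrite !pairE; apply: Hy.
- by case: eqP => _ h; [left; apply/AR|right; apply/BS]; exists (snd_nat y).
Qed.

Lemma sigma2_bool (b : bool) : Sigma 2 [set _ | b].
Proof.
apply/sigma2P; exists (fun _ _ _ => b); first by tc_auto.
by move=> x; split=> [h|[_ /(_ 0)]]; first by exists 0.
Qed.

Lemma diff_union_inter X X' : diff_union X -> diff_union X' -> diff_union (X `&` X').
Proof.
move=> dX dX'; elim: dX => {X} [A B sA sB|X1 X2 _ IH1 _ IH2]; last first.
  by rewrite setIUl; apply: du_union.
elim: dX' => {X'} [A' B' sA' sB'|X1 X2 _ IH1 _ IH2]; last first.
  by rewrite setIUr; apply: du_union.
have -> : (A `\` B) `&` (A' `\` B') = (A `&` A') `\` (B `|` B').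
  apply/seteqP; split=> x.
    by move=> [[a nb] [a' nb']]; split=> // -[].
  by move=> [[a a'] nb]; do !split=> //; move=> h; apply: nb; [left|right].
by apply: du_diff; [apply: sigma2_inter|apply: sigma2_union].
Qed.

Lemma diff_union_compl X : diff_union X -> diff_union (~` X).
Proof.
elim=> {X} [A B sA sB|X1 X2 _ IH1 _ IH2]; last by rewrite setCU; apply: diff_union_inter.
(* Outside [A] or inside [B], each written as a difference with a trivial Sigma_2 set. *)
have -> : ~` (A `\` B) = ([set _ | true] `\` A) `|` (B `\` [set _ | false]).
  apply/seteqP; split=> x /=.
    move=> h; case: (pselect (A x)) => a; last by left.
    by right; split=> //; apply: contrapT => nb; apply: h.
  by move=> [[_ na] []|[b _] [_]].
by apply: du_union; apply: du_diff => //; apply: sigma2_bool.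
Qed.

Lemma boolean_combination_colorable X :
  boolean_combination (Sigma 2) X -> colorable X.
Proof.
move=> bX; suff : diff_union X.
  elim=> {bX X} [A B|X X' _ cX _]; [exact: colorable_diff|exact: colorable_union].
elim: bX => {X} [A sA|X _|X X' _ dX _|X X' _ dX _].
- have -> : A = A `\` [set _ | false] by apply/seteqP; split=> x // [].
  by apply: du_diff => //; apply: sigma2_bool.
- exact: diff_union_compl.
- exact: du_union.
- exact: diff_union_inter.
Qed.

Lemma tc_nth x0 (l : seq nat) : tc (fun c => nth x0 l c).
Proof.
elim: l => [|a l IH]; first by under eq_fun do rewrite nth_nil; tc_auto.
apply: (@tc_eq (fun c => if c == 0 then a else nth x0 l c.-1)); first by case.
by tc_auto.
Qed.

Theorem theorem4p5 (X : set nat)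
    (X_pos : X `<=` ~` [set 0])
    (X_bc : boolean_combination (Sigma 2) X) :
  (exists L : computable_linear_order,
     computable_copy_of_omega L /\
     forall C : set nat, Delta 2 C -> cohesive C ->
       has_type_omega_plus_shuffle
         (finite_types_with X (plus (plus omega zeta_eta) (reverse omega)))
         (cohesive_power L C)) /\
  (finite_set X -> X !=set0 ->
   exists L : computable_linear_order,
     computable_copy_of_omega L /\
     forall C : set nat, Delta 2 C -> cohesive C ->
       has_type_omega_plus_shuffle (finite_types X)
         (cohesive_power L C)).
Proof.
have X0 : ~ X 0 by move=> /X_pos; apply.
split.
  have [kf [P [H [t1 t2 t3 [lim col ncol]]]]] := boolean_combination_colorable X_bc.
  (* A new color 0 of size 0, refuted at once: its blocks at level [j] have exactly [j.+1] elements.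
     It produces the infinite block type and populates every level even if [X] is empty. *)
  pose kf' c := if c == 0 then 0 else kf c.-1.
  pose P' c z := if c == 0 then false else P c.-1 z.
  pose H' c j s := if c == 0 then true else H c.-1 j s.
  have t1' : tc kf' by rewrite /kf'; tc_auto.
  have t2' : tc2 (fun c z => P' c z) by rewrite /P'; tc_auto.
  have t3' : tc3 (fun c j s => H' c j s) by rewrite /H'; tc_auto.
  have lim' c j : exists b, eventually (fun s => H' c j s = b).
    by case: c => [|c]; [exists true; apply: ae_all|apply: lim].
  have sol : solid kf' P' H' 0.
    by split=> j; [apply: ae_all|exists 0].
  exists (colored_omega t1' t2' t3' lim' sol); split; first exact: colored_omega_copy.
  move=> C [sC _] coh.
  apply: (power_has_type t1' t2' t3' lim' sol coh sC (X := X) (big := True)) => //.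
  - move=> k /col [c [e Pc Hc]]; exists c.+1; split=> //.
  - move=> k _ /ncol [N HN]; exists N => -[|c] j s; first by move=> _ /(_ 0).
    by move=> e Pc Hc /ltnW; apply: HN e Pc Hc.
  - by move=> _; exists 0; split=> [|j]; [exists 0|apply: ae_all].
  - move=> Z; split=> [[h|->]|[h|[_ ->]]];
      [by left|by right|by left|by right].
move=> /finite_seqP [l lX] [x0 Xx0].
(* Indices beyond the list [l] of [X] default to [x0], so all sizes are in [X]; no color is ever
   refuted or withheld, hence no infinite block arises. *)
pose kf c := nth x0 l c; pose P (_ _ : nat) := true; pose H (_ _ _ : nat) := true.
have kX c : X (kf c).
  rewrite /kf; case: (ltnP c (size l)) => lt; last by rewrite nth_default.
  by rewrite lX /=; apply: mem_nth.
have t1 : tc kf := tc_nth x0 l.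
have t2 : tc2 (fun c z => P c z) by rewrite /P; tc_auto.
have t3 : tc3 (fun c j s => H c j s) by rewrite /H; tc_auto.
have lim c j : exists b, eventually (fun s => H c j s = b).
  by exists true; apply: ae_all.
have sol : solid kf P H 0.
  split=> j; [by apply: ae_all|exists 0; rewrite /valid].
  by have := kX 0; case: (kf 0) => // /X0.
exists (colored_omega t1 t2 t3 lim sol); split; first exact: colored_omega_copy.
move=> C [sC _] coh.
apply: (power_has_type t1 t2 t3 lim sol coh sC (X := X) (big := False)) => //.
- move=> k; rewrite lX /= => kl; exists (seq.index k l); rewrite /kf nth_index //.
  by split=> // j; apply: ae_all.
- by move=> k _ nX; exists 0 => c j s e; case: nX; rewrite -e.
- move=> _; split=> //; exists (maxn x0 (\max_(i <- l) i)) => c; rewrite leq_max.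
  have [lt|le] := ltnP c (size l); last by rewrite /kf nth_default // leqnn.
  by rewrite (@leq_bigmax_seq _ _ _ id) ?orbT //; apply: mem_nth.
- by move=> Z; split=> [|[|[]] //]; left.
Qed.
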